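(* Let $k$ be a noetherian commutative ring, let $\mathbf D$ be a generalized divided power algebra over $k$, and let $M$ be a finitely presented $\mathbf D$-module (graded or ungraded). Then $\mathrm{sd}(M)<\infty$; that is, $M$ admits a finite-length resolution by special $\mathbf D$-modules. Moreover, if $k$ has finite Krull dimension $d$, then $\mathrm{sd}(M)\le d+1$.
   Context: All rings are commutative with $1$. $\pi$-sequences. Let $k$ be a commutative ring. A $\pi$-sequence in $k$ is a sequence $\pi_\bullet=(\pi_n)_{n\ge 2}$ in $k$, with the convention $\pi_1=0$. For integers $j\ge1$ and $n,m\ge0$ put $\epsilon_j(n,m)=\lfloor (n+m)/j\rfloor-\lfloor n/j\rfloor-\lfloor m/j\rfloor$. For $0\le m\le n$ put $C(n,m)=\prod_{j\ge 2}\pi_j^{\epsilon_j(n-m,m)}$. The sequence is admissible if, whenever $(\pi_n,\pi_m)$ is not the unit ideal, $n\mid m$ or $m\mid n$. GDPAs. $\mathbf D(k,\pi_\bullet)$ is the graded $k$-algebra free on basis $x^{[i]}$ ($i\ge0$, $\deg x^{[i]}=i$) with $x^{[n-m]}x^{[m]}=C(n,m)x^{[n]}$. A GDPA over $k$ is a graded $k$-algebra isomorphic to $\mathbf D(k,\pi_\bullet)$ with $\pi_\bullet$ admissible. Special modules. Let $h\ge1$ be an integer and $\mathfrak a$ an ideal of $k$ containing $\pi_h$. Then the $k$-span of the $x^{[n]}$ with $h\nmid n$ in $\mathbf D/\mathfrak a\mathbf D$ is an ideal. The quotient by this ideal, i.e. $\bigoplus_{h\mid n}(k/\mathfrak a)x^{[n]}$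 as a $\mathbf D$-module, is denoted $(\mathbf D/\mathfrak a\mathbf D)^{(h)}$. - A $\mathbf D$-module is principal special if it is isomorphic to some $(\mathbf D/\mathfrak a\mathbf D)^{(h)}$ with $\pi_h\in\mathfrak a$. - It is special if it has a finite filtration whose successive quotients are principal special. - A special resolution of $M$ is a resolution $S_\bullet\to M$ with every $S_i$ special. - The special dimension $\mathrm{sd}(M)$ is the minimal $n$ such that $M$ has a special resolution with $S_i=0$ for $i>n$, or $\infty$ if none exists. In the graded setting the same definitions are used with graded modules, allowing shifts. *)

(* Defs.v *)
From HB Require Import structures.
From mathcomp Require Import all_boot all_order all_algebra.
Set Implicit Arguments. Unset Strict Implicit. Unset Printing Implicit Defensive.
Import Order.TTheory GRing.Theory Num.Theory.
Local Open Scope ring_scope.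

Section CommAlg.
Context {k : comPzRingType}.

Definition is_ideal (I : k -> Prop) : Prop :=
  ((I 0) /\
     ((forall a b, I a -> I b -> I (a + b))) /\
     ((forall r a, I a -> I (r * a)))).

Definition in_ideal_gen (s : seq k) (c : k) : Prop :=
  exists u : 'I_(size s) -> k, c = \sum_(i < size s) u i * s`_i.

Definition noetherian : Prop :=
  forall I : k -> Prop, is_ideal I ->
    exists s : seq k, forall c, I c <-> in_ideal_gen s c.

Definition is_prime_ideal (P : k -> Prop) : Prop :=
  ((is_ideal P) /\
     (~ P 1) /\
     (forall a b, P (a * b) -> P a \/ P b)).

Definition prime_chain (n : nat) (p : nat -> k -> Prop) : Prop :=
  (forall i, (i <= n)%N -> is_prime_ideal (p i)) /\
  (forall i, (i < n)%N ->
     (forall c, p i c -> p i.+1 c) /\ exists c, p i.+1 c /\ ~ p i c).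

Definition krull_dim (d : nat) : Prop :=
  (exists p, prime_chain d p) /\ (forall n p, prime_chain n p -> (n <= d)%N).

(* A pi-sequence is given by pi : nat -> k; only the values at n >= 2
   matter, and the convention pi_1 = 0 is built into [piv]. *)
Definition piv (pi : nat -> k) (n : nat) : k := if (n <= 1)%N then 0 else pi n.

Definition eps (j n m : nat) : nat := ((n + m) %/ j - n %/ j - m %/ j)%N.

(* C(n,m) = prod_{j >= 2} pi_j^{eps_j(n-m,m)}; factors with j > n are 1. *)
Definition Ccoef (pi : nat -> k) (n m : nat) : k :=
  \prod_(2 <= j < n.+1) piv pi j ^+ eps j (n - m) m.

Definition unit_ideal2 (a b : k) : Prop := exists u v : k, u * a + v * b = 1.

Definition admissible (pi : nat -> k) : Prop :=
  forall n m, (1 <= n)%N -> (1 <= m)%N ->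
    ~ unit_ideal2 (piv pi n) (piv pi m) -> (n %| m)%N \/ (m %| n)%N.
End CommAlg.

(* D is a commutative k-algebra (structure map iota), x n = x^[n].
   [is_GDPA] says x is a k-basis of D with the multiplication rule of
   D(k,pi), i.e. D is (graded-)isomorphic to D(k,pi), the grading of D
   being deg x^[n] = n. *)
Definition is_GDPA {k : comPzRingType} {D : comPzRingType}
  (iota : {rmorphism k -> D}) (pi : nat -> k) (x : nat -> D) : Prop :=
  ((admissible pi) /\
     ((forall n m, (m <= n)%N -> x (n - m)%N * x m = iota (Ccoef pi n m) * x n)) /\
     ((forall d : D, exists (N : nat) (c : nat -> k),
          d = \sum_(i < N) iota (c i) * x i)) /\
     ((forall (N : nat) (c : nat -> k),
          \sum_(i < N) iota (c i) * x i = 0 -> forall i, (i < N)%N -> c i = 0))).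

Section Modules.
Context {k : comPzRingType} {D : comPzRingType}
  (iota : {rmorphism k -> D}) (pi : nat -> k) (x : nat -> D).

Definition homD (t : int) (d : D) : Prop :=
  d = 0 \/ exists (c : k) (n : nat), t = n%:Z /\ d = iota c * x n.

Definition Dlinear (M N : lmodType D) (f : M -> N) : Prop :=
  forall (a : D) (u v : M), f (a *: u + v) = a *: f u + f v.

Definition is_grading (M : lmodType D) (H : int -> M -> Prop) : Prop :=
  (((forall t, H t 0)) /\
     ((forall t u v, H t u -> H t v -> H t (u + v))) /\
     ((forall t (c : k) u, H t u -> H t (iota c *: u))) /\
     ((forall t (i : nat) u, H t u -> H (t + i%:Z) (x i *: u))) /\
     ((forall m : M, exists (s : seq int) (f : int -> M),
          [/\ uniq s, (forall t, H t (f t)) & m = \sum_(t <- s) f t])) /\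
     ((forall (s : seq int) (f : int -> M), uniq s -> (forall t, H t (f t)) ->
          \sum_(t <- s) f t = 0 -> forall t, t \in s -> f t = 0))).

Definition submod (gr : bool) (M : lmodType D) (H : int -> M -> Prop)
  (P : M -> Prop) : Prop :=
  ((P 0) /\
     ((forall (a : D) u v, P u -> P v -> P (a *: u + v))) /\
     ((gr -> forall (s : seq int) (f : int -> M), uniq s -> (forall t, H t (f t)) ->
          P (\sum_(t <- s) f t) -> forall t, t \in s -> P (f t)))).

(* Q / P is principal special: Q/P ~= (D/aD)^(h) (shifted by sh in the
   graded case); e j is the image of x^[h*j] under the isomorphism. *)
Definition psp_quot (gr : bool) (M : lmodType D) (H : int -> M -> Prop)
  (P Q : M -> Prop) : Prop :=
  exists (h : nat) (a : k -> Prop) (sh : int) (e : nat -> M),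
  (((1 <= h)%N) /\
     (is_ideal a) /\
     (a (piv pi h)) /\
     ((forall j, Q (e j) /\ (gr -> H (sh + (h * j)%N%:Z) (e j)))) /\
     ((forall (i j : nat),
          if (h %| i)%N then
            P (x i *: e j - iota (Ccoef pi (h * j + i) (h * j)) *: e (j + i %/ h)%N)
          else P (x i *: e j))) /\
     ((forall (c : k) j, a c -> P (iota c *: e j))) /\
     ((forall m, Q m -> exists (N : nat) (c : nat -> k),
          P (m - \sum_(j < N) iota (c j) *: e j))) /\
     ((forall (N : nat) (c : nat -> k), P (\sum_(j < N) iota (c j) *: e j) ->
          forall j, (j < N)%N -> a (c j)))).

Definition principal_special (gr : bool) (M : lmodType D) (H : int -> M -> Prop) : Prop :=
  psp_quot gr H (fun m => m = 0) (fun _ => True).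

Definition special (gr : bool) (M : lmodType D) (H : int -> M -> Prop) : Prop :=
  exists (r : nat) (F : nat -> M -> Prop),
  (((forall m, F 0%N m <-> m = 0)) /\
     ((forall m, F r m)) /\
     ((forall j m, F j m -> F j.+1 m)) /\
     ((forall j, submod gr H (F j))) /\
     ((forall j, (j < r)%N -> psp_quot gr H (F j) (F j.+1)))).

Definition special_resolution_of_length (gr : bool) (M : lmodType D)
  (H : int -> M -> Prop) (n : nat) : Prop :=
  exists (S : nat -> lmodType D) (HS : forall i, int -> S i -> Prop)
         (d : forall i, S i.+1 -> S i) (ep : S 0%N -> M),
  (((forall i, Dlinear (d i)) /\ Dlinear ep) /\
     ((forall m, exists s, ep s = m)) /\
     ((forall s : S 0%N, ep s = 0 <-> exists t, d 0%N t = s)) /\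
     ((forall i (s : S i.+1), d i s = 0 <-> exists t, d i.+1 t = s)) /\
     ((forall i, special gr (HS i))) /\
     ((gr -> (forall i, is_grading (HS i)) /\
             (forall i t s, HS i.+1 t s -> HS i t (d i s)) /\
             (forall t s, HS 0%N t s -> H t (ep s)))) /\
     ((forall i, (n < i)%N -> forall s : S i, s = 0))).

Definition fin_presented (gr : bool) (M : lmodType D) (H : int -> M -> Prop) : Prop :=
  exists (n : nat) (g : 'I_n -> M) (dg : 'I_n -> int)
         (r : nat) (rel : 'I_r -> 'I_n -> D) (rdg : 'I_r -> int),
  (((gr -> forall i, H (dg i) (g i))) /\
     ((gr -> forall l i, homD (rdg l - dg i) (rel l i))) /\
     ((forall m, exists a : 'I_n -> D, m = \sum_(i < n) a i *: g i)) /\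
     ((forall l, \sum_(i < n) rel l i *: g i = 0)) /\
     ((forall a : 'I_n -> D, \sum_(i < n) a i *: g i = 0 ->
          exists b : 'I_r -> D, forall i, a i = \sum_(l < r) b l * rel l i))).
End Modules.

(* Main.v *)
Require Import Defs.
From HB Require Import structures.
From mathcomp Require Import all_boot all_order all_algebra.
From mathcomp Require Import boolp.
Import Order.TTheory GRing.Theory Num.Theory.
Local Open Scope ring_scope.
Set Implicit Arguments. Unset Strict Implicit. Unset Printing Implicit Defensive.

(* A special module has a free cover with special kernel, so the modules
   having a special [n]-th syzygy are stable under extensions (horseshoe
   lemma), and one can argue by noetherian induction on an ideal [a] of [k]
   killing the module [M].  If [b c] lies in [a] but [b] and [c] do not, then
   [M] is an extension of [M/bM] by [bM], which are killed by larger ideals.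
   If [a = p] is prime, let [K] be the kernel of a free cover [F -> M].
   Choose [h] with [pi_h] in [p]: the filtration of [F/pF] by residues of
   degrees modulo [h] has all quotients isomorphic to [(D/pD)^(h)].  If [h]
   is the largest index with [pi_h] in [p], this behaves like a polynomial
   ring over a domain; if there are arbitrarily large such [h], take [h]
   beyond the degrees of all generators of [K], which then have constant
   coefficients. In both cases Gaussian elimination by pseudo-division gives
   a special [K' <= K] and [c] outside [p] with [c K <= K']. The module
   [K/K'] is killed by [p + (c)], which has smaller dimension, so that
   passing from [M] to [K] costs one syzygy step per prime in a chain. Finite
   presentation of [bM] and of [K/K'] (coherence of [D]) comes out of the
   same induction, since modules of finite special dimension have resolutions
   by finite free modules. *)

(** [D] need not be noetherian, so finite generation of kernels is never free and finite
    presentation has to travel through the induction. What makes this possible is that the induction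
    hypothesis turns [FP 2] into [FP n] for every [n], while passing to a kernel loses only one
    index.

    Admissibility enters through two facts on structure constants. If [a] contains [pi_h] and
    [r < h], then [C(hj+r, r)] is a unit modulo [a], so every residue class modulo [h] looks like
    the class of 0. If [h] is the largest index with [pi_h] in [p], the constants between multiples
    of [h] stay outside [p], so leading terms survive multiplication. For ordinary divided powers in
    positive characteristic no largest [h] exists and leading terms do die; this forces the second
    choice of [h], where only constant leading terms occur.

    Elimination needs denominators, which is why it only reaches [K'] with [c K <= K'], and why a
    torsion quotient is left to the induction.

    Modules are treated as subquotients [Q/P] of an ambient module and isomorphisms as relations, so
    that no quotient module has to be built. *)

Section Ideals.
Context {k : comPzRingType}.
Implicit Types (a p : k -> Prop).

Lemma ideal0 a : is_ideal a -> a 0. Proof. by case. Qed.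
Lemma idealD a u v : is_ideal a -> a u -> a v -> a (u + v).
Proof. by case=> _ [+ _]; apply. Qed.
Lemma idealM a r u : is_ideal a -> a u -> a (r * u).
Proof. by case=> _ [_ +]; apply. Qed.
Lemma idealMr a r u : is_ideal a -> a u -> a (u * r).
Proof. by move=> ? ?; rewrite mulrC; apply: idealM. Qed.
Lemma ideal_sum a (I : Type) (r : seq I) (P : pred I) (F : I -> k) :
  is_ideal a -> (forall i, P i -> a (F i)) -> a (\sum_(i <- r | P i) F i).
Proof.
by move=> ia h; apply: big_ind => //; [apply: ideal0|move=> ? ?; apply: idealD].
Qed.

Definition ideal_add a (f c : k) := exists u r, a u /\ c = u + r * f.
Definition ideal_colon a (f c : k) := a (c * f).

Lemma is_ideal_add a f : is_ideal a -> is_ideal (ideal_add a f).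
Proof.
move=> ia; split; last split.
- by exists 0, 0; split; [apply: ideal0|rewrite mul0r addr0].
- move=> _ _ [u [r [au ->]]] [v [s [av ->]]]; exists (u + v), (r + s).
  by split; [apply: idealD|rewrite mulrDl addrACA].
- move=> t _ [u [r [au ->]]]; exists (t * u), (t * r).
  by split; [apply: idealM|rewrite mulrDr mulrA].
Qed.

Lemma is_ideal_colon a f : is_ideal a -> is_ideal (ideal_colon a f).
Proof.
move=> ia; rewrite /ideal_colon; split; last split.
- by rewrite mul0r; apply: ideal0.
- by move=> u v; rewrite mulrDl; apply: idealD.
- by move=> r u; rewrite -mulrA; apply: idealM.
Qed.

Lemma ideal_add_sub a f c : is_ideal a -> a c -> ideal_add a f c.
Proof. by move=> ia ac; exists c, 0; rewrite mul0r addr0. Qed.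

Lemma ideal_add_gen a f : is_ideal a -> ideal_add a f f.
Proof. by move=> ia; exists 0, 1; split; [apply: ideal0|rewrite mul1r add0r]. Qed.

Definition unit_mod a c := exists u, a (1 - u * c).

Lemma unit_modM a c d : is_ideal a -> unit_mod a c -> unit_mod a d -> unit_mod a (c * d).
Proof.
move=> ia [u au] [v av]; exists (u * v).
have -> : 1 - u * v * (c * d) = (1 - u * c) + (u * c) * (1 - v * d).
  by rewrite mulrBr mulr1 addrA subrK mulrACA.
by apply: idealD => //; apply: idealM.
Qed.

Lemma unit_mod1 a : is_ideal a -> unit_mod a 1.
Proof. by move=> ia; exists 1; rewrite mulr1 subrr; apply: ideal0. Qed.

Lemma unit_modP a c d : is_ideal a -> unit_mod a c -> a (d * c) -> a d.
Proof.
move=> ia [u au] adc.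
have -> : d = d * (1 - u * c) + u * (d * c).
  by rewrite mulrBr mulr1 mulrCA subrK.
by apply: idealD => //; apply: idealM.
Qed.

Lemma prime_exp p c e : is_prime_ideal p -> ~ p c -> ~ p (c ^+ e).
Proof.
case=> [_ [p1 pM]] pc; elim: e => [|e IH]; first by rewrite expr0.
by rewrite exprS => /pM [].
Qed.
Lemma prime_mul p c d : is_prime_ideal p -> ~ p c -> ~ p d -> ~ p (c * d).
Proof. by case=> [_ [_ pM]] pc pd /pM []. Qed.

(* Ascending chains stabilise: otherwise dependent choice yields a strictly
   ascending sequence whose union has finitely many generators. *)
Lemma noetherian_ind (C : (k -> Prop) -> Prop) :
  noetherian (k := k) ->
  (forall a, is_ideal a ->
    (forall b, is_ideal b -> (forall c, a c -> b c) -> (exists2 c, b c & ~ a c) -> C b) ->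
    C a) ->
  forall a, is_ideal a -> C a.
Proof.
move=> noe step a0 ia0; apply: contrapT => nC.
pose T := {a : k -> Prop | is_ideal a /\ ~ C a}.
have nxt (t : T) : exists t' : T, (forall c, sval t c -> sval t' c)
    /\ exists2 c, sval t' c & ~ sval t c.
  case: t => a [ia na] /=; apply: contrapT => H; apply: na; apply: step => // b ib ab Hex.
  apply: contrapT => nb; apply: H.
  by exists (exist _ b (conj ib nb)).
have [F HF] := choice nxt.
pose s n := sval (iter n F (exist _ a0 (conj ia0 nC))).
have idl n : is_ideal (s n) by exact: (svalP (iter n F (exist _ a0 (conj ia0 nC)))).1.
have mono n m c : (n <= m)%N -> s n c -> s m c.
  move=> nm; rewrite -(subnKC nm); elim: (m - n)%N => [|e IH]; first by rewrite addn0.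
  by rewrite addnS => sn; rewrite /s iterS; apply: (HF _).1; apply: IH.
pose U c := exists n, s n c.
have iU : is_ideal U.
  split; first by exists 0%N; exact: ideal0 (idl 0%N).
  split.
    move=> u v [n un] [m vm]; exists (maxn n m); apply: idealD; first exact: idl.
      by apply: mono un; apply: leq_maxl.
    by apply: mono vm; apply: leq_maxr.
  by move=> r u [n un]; exists n; apply: idealM => //; apply: idl.
have [g Hg] := noe U iU.
have [N HN] : exists N, forall i : 'I_(size g), s N g`_i.
  have Hi (i : 'I_(size g)) : exists n, s n g`_i.
    apply/Hg; exists (fun j => (j == i)%:R).
    rewrite (bigD1 i) //= eqxx mul1r big1 ?addr0 // => j /negPf ->.
    by rewrite mul0r.
  have [f Hf] := choice Hi; exists (\max_i f i)%N => i.
  by apply: mono (Hf i); apply: leq_bigmax.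
have [c sc nsc] := (HF (iter N F (exist _ a0 (conj ia0 nC)))).2.
apply: nsc; have /Hg [u ->] : U c by exists N.+1.
by apply: ideal_sum => [|i _]; [apply: idl|apply: idealM; [apply: idl|apply: HN]].
Qed.

End Ideals.

(** * Carries and structure constants modulo an ideal *)

Section StructureConstants.
Context {k : comPzRingType} (pi : nat -> k).
Implicit Types (a : k -> Prop).

Lemma eps_ge1 j n m : (0 < j)%N -> (j <= n %% j + m %% j)%N -> (1 <= eps j n m)%N.
Proof.
move=> j0 H; rewrite /eps.
rewrite (divnD n m j0) H addn1 -subnDA -addnS.
by rewrite addnS subSnn.
Qed.

Lemma eps_dvd j n m : (j %| n)%N -> eps j n m = 0%N.
Proof.
case: j => [|j] H; first by rewrite /eps !divn0.
by rewrite /eps divnDl // -subnDA subnn.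
Qed.

Lemma eps_small j n m : (n %% j + m %% j < j)%N -> eps j n m = 0%N.
Proof.
case: j => [|j] // H; rewrite /eps divnD // leqNgt H addn0.
by rewrite -subnDA subnn.
Qed.

(** Adding [i] and [j] carries modulo [h], so [pi_h] occurs in the product with positive
    exponent. *)
Lemma Ccoef_carry a h i j : is_ideal a -> (1 <= h)%N -> a (piv pi h) ->
  (h <= i %% h + j %% h)%N -> a (Ccoef pi (i + j) j).
Proof.
move=> ia h1 ah car.
have h2 : (2 <= h)%N by move: h1 car; rewrite leq_eqVlt => /orP[/eqP<-|//]; rewrite !modn1.
have hij : (h < (i + j).+1)%N.
  by rewrite ltnS; apply: leq_trans car _; apply: leq_add; apply: leq_mod.
rewrite /Ccoef (big_cat_nat _ (n := h)) //= 1?ltnW //.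
rewrite (big_ltn hij) addnK.
have := eps_ge1 h1 car; case: (eps h i j) => // e _.
by apply: idealM => //; apply: idealMr => //; rewrite exprS; apply: idealMr.
Qed.

(** If [pi_l] and [pi_h] are not comaximal, admissibility leaves two cases. For [l | h] also
    [l | i]; for [h | l] the residue of [i] modulo [l] is a multiple of [h], hence at most [l - h],
    while [j < h]. Neither addition carries modulo [l], so the exponent is 0. Every other [pi_l] is
    a unit modulo [a], because [pi_h] lies in [a]. *)
Lemma Ccoef_unit a h i j : admissible pi -> is_ideal a -> (1 <= h)%N -> a (piv pi h) ->
  (h %| i)%N -> (j < h)%N -> unit_mod a (Ccoef pi (i + j) j).
Proof.
move=> adm ia h1 ah hi jh; rewrite /Ccoef addnK big_nat_cond.
apply: (big_ind (unit_mod a)); [exact: unit_mod1|by move=> *; apply: unit_modM|].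
move=> l /andP[/andP[l2 _] _].
have [u2|nu] := pselect (unit_ideal2 (piv pi l) (piv pi h)).
  elim: (eps l i j) => [|e IH]; first by rewrite expr0; apply: unit_mod1.
  rewrite exprS; apply: unit_modM => //.
  case: u2 => u [v uv]; exists u; rewrite -uv addrC addKr.
  by apply: idealM.
suff -> : eps l i j = 0%N by rewrite expr0; apply: unit_mod1.
have [lh|hl] := adm l h (ltnW l2) h1 nu.
  by apply: eps_dvd; apply: dvdn_trans lh hi.
have l0 : (0 < l)%N by apply: leq_trans l2.
apply: eps_small.
case/dvdnP: hl l0 l2 => q -> l0 l2; case/dvdnP: hi => r ->.
have q0 : (0 < q)%N by move: l0; rewrite muln_gt0 => /andP[].
rewrite -muln_modl (modn_small (m := j)); last first.
  by apply: leq_trans jh _; rewrite -{1}[h]mul1n leq_mul2r q0 orbT.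
apply: leq_trans (_ : (r %% q).+1 * h <= _)%N; first by rewrite mulSn addnC ltn_add2r.
by rewrite leq_mul2r ltn_mod q0 orbT.
Qed.

Lemma Ccoefn0 n : Ccoef pi n 0 = 1.
Proof.
rewrite /Ccoef big1 // => j _.
by rewrite /eps div0n addn0 !subn0 subnn expr0.
Qed.

Lemma Ccoef_sym i j : Ccoef pi (i + j) i = Ccoef pi (i + j) j.
Proof.
rewrite /Ccoef addnK addKn; apply: eq_bigr => l _; congr (_ ^+ _).
by rewrite /eps addnC -!subnDA [(j %/ l + _)%N]addnC.
Qed.

(** Only the factors [pi_l] in [p] matter. Two elements of [p] are never comaximal, so [l] and [h]
    are comparable, and maximality of [h] forces [l | h]. Then [l | i] and the exponent is 0. *)
Lemma Ccoef_nprime p h i j : admissible pi -> is_prime_ideal p -> (1 <= h)%N ->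
  p (piv pi h) -> (forall t, (1 <= t)%N -> p (piv pi t) -> (t <= h)%N) ->
  (h %| i)%N -> ~ p (Ccoef pi (i + j) j).
Proof.
move=> adm pp h1 ph hmax hi; rewrite /Ccoef addnK big_nat_cond.
have [ip [p1 pM]] := pp.
apply: (big_ind (fun c => ~ p c)) => //; first by move=> *; apply: prime_mul.
move=> l /andP[/andP[l2 _] _].
have [pl|] := pselect (p (piv pi l)); last exact: prime_exp.
have [|lh|hl] := adm l h (ltnW l2) h1.
- by case=> u [v uv]; apply: p1; rewrite -uv; apply: idealD => //; apply: idealM.
- by rewrite eps_dvd ?expr0 //; apply: dvdn_trans lh hi.
- have lh : l = h.
    by apply/eqP; rewrite eqn_leq hmax ?(ltnW l2) //= dvdn_leq ?(ltnW l2).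
  by rewrite eps_dvd ?expr0 // lh.
Qed.

End StructureConstants.

(** * Coefficients with respect to the basis [x] *)

Section Coefficients.
Context {k D : comPzRingType} {iota : {rmorphism k -> D} } { pi : nat -> k}
  {x : nat -> D} (HG : is_GDPA iota pi x).

Lemma gdpa_expansion d : exists (c : nat -> k) N,
  (forall m, (N <= m)%N -> c m = 0) /\ d = \sum_(i < N) iota (c i) * x i.
Proof using HG.
have [_ [_ [/(_ d) [N [c ->]] _]]] := HG.
exists (fun i => if (i < N)%N then c i else 0), N; split.
  by move=> m; rewrite leqNgt => /negPf ->.
by apply: eq_bigr => i _; rewrite ltn_ord.
Qed.

Definition dcoef (d : D) : nat -> k := sval (cid (gdpa_expansion d)).

Lemma dcoefP d : exists N, (forall m, (N <= m)%N -> dcoef d m = 0) /\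
  d = \sum_(i < N) iota (dcoef d i) * x i.
Proof. exact: (svalP (cid (gdpa_expansion d))). Qed.

Lemma sum_widen (c : nat -> k) N N' : (N <= N')%N -> (forall m, (N <= m)%N -> c m = 0) ->
  \sum_(i < N) iota (c i) * x i = \sum_(i < N') iota (c i) * x i.
Proof.
move=> le c0; rewrite (big_ord_widen _ (fun i => iota (c i) * x i) le) big_mkcond.
by apply: eq_bigr => i _; case: ltnP => // /c0 ->; rewrite rmorph0 mul0r.
Qed.

Lemma dcoef_unique d (c : nat -> k) N : (forall m, (N <= m)%N -> c m = 0) ->
  d = \sum_(i < N) iota (c i) * x i -> forall m, dcoef d m = c m.
Proof.
move=> c0 dE m; have [N' [c0' dE']] := dcoefP d.
have [_ [_ [_ free]]] := HG.
pose L := maxn m.+1 (maxn N N').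
have NL : (N <= L)%N by rewrite /L !leq_max leqnn !orbT.
have NL' : (N' <= L)%N by rewrite /L !leq_max leqnn !orbT.
apply/eqP; rewrite -subr_eq0; apply/eqP.
apply: (free L (fun i => dcoef d i - c i)) => [|]; last by rewrite /L leq_max leqnn.
under eq_bigr => i _ do rewrite rmorphB mulrBl.
by rewrite sumrB -(sum_widen NL c0) -(sum_widen NL' c0') -dE -dE' subrr.
Qed.

Lemma dcoef_expand d N : (forall m, (N <= m)%N -> dcoef d m = 0) ->
  d = \sum_(i < N) iota (dcoef d i) * x i.
Proof.
move=> c0; have [N' [c0' dE]] := dcoefP d.
rewrite {1}dE; case: (leqP N N') => le; last by apply: sum_widen => //; apply: ltnW.
by rewrite -(sum_widen le).
Qed.

Lemma dcoef_ext d d' : (forall m, dcoef d m = dcoef d' m) -> d = d'.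
Proof.
move=> E; have [N [c0 ->]] := dcoefP d'.
rewrite -(@eq_bigr _ _ _ _ _ _ (fun i : 'I_N => iota (dcoef d i) * x i)) => [|i _];
  last by rewrite E.
by apply: dcoef_expand => m /c0; rewrite E.
Qed.

Lemma dcoefD d d' m : dcoef (d + d') m = dcoef d m + dcoef d' m.
Proof.
have [N [c0 dE]] := dcoefP d; have [N' [c0' dE']] := dcoefP d'.
apply: (@dcoef_unique _ (fun m => dcoef d m + dcoef d' m) (maxn N N')) => [{}m|].
  by rewrite geq_max => /andP[/c0 -> /c0' ->]; rewrite addr0.
under eq_bigr => i _ do rewrite rmorphD mulrDl.
by rewrite big_split /= -(sum_widen (leq_maxl _ _) c0) -(sum_widen (leq_maxr _ _) c0') -dE -dE'.
Qed.

Lemma dcoefZ a d m : dcoef (iota a * d) m = a * dcoef d m.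
Proof.
have [N [c0 dE]] := dcoefP d.
apply: (@dcoef_unique _ (fun m => a * dcoef d m) N) => [{}m /c0 ->|]; first by rewrite mulr0.
by rewrite {1}dE big_distrr /=; apply: eq_bigr => i _; rewrite rmorphM mulrA.
Qed.

Lemma dcoef0 m : dcoef 0 m = 0.
Proof. by rewrite -(mulr0 (iota 0)) dcoefZ mul0r. Qed.

Lemma dcoefN d m : dcoef (- d) m = - dcoef d m.
Proof. by apply/eqP; rewrite -addr_eq0 -dcoefD addNr dcoef0. Qed.

Lemma dcoef_sum (I : Type) (r : seq I) (P : pred I) (F : I -> D) m :
  dcoef (\sum_(i <- r | P i) F i) m = \sum_(i <- r | P i) dcoef (F i) m.
Proof. by elim/big_rec2: _ => [|i a b _ <-]; rewrite ?dcoef0 ?dcoefD. Qed.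

Lemma dcoef_x n m : dcoef (x n) m = (m == n)%:R.
Proof.
apply: (@dcoef_unique _ (fun m => (m == n)%:R) n.+1) => [{}m|].
  by case: eqVneq => // ->; rewrite ltnn.
rewrite (bigD1 ord_max) //= eqxx rmorph1 mul1r big1 ?addr0 // => i /negPf.
by rewrite -val_eqE /= => ->; rewrite rmorph0 mul0r.
Qed.

Lemma mulxx i j : x i * x j = iota (Ccoef pi (i + j) j) * x (i + j)%N.
Proof.
have [_ [H _]] := HG.
by have := H (i + j)%N j (leq_addl _ _); rewrite addnK.
Qed.

Lemma dcoef_xM i d m :
  dcoef (x i * d) m = if (i <= m)%N then Ccoef pi m i * dcoef d (m - i)%N else 0.
Proof.
have [N [c0 {1}->]] := dcoefP d.
rewrite big_distrr /= dcoef_sum.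
under eq_bigr => j _ do rewrite mulrCA dcoefZ mulxx dcoefZ dcoef_x.
case: leqP => im; last first.
  rewrite big1 // => j _; rewrite ltn_eqF ?mulr0 //.
  by apply: leq_trans im _; apply: leq_addr.
have [mN|Nm] := ltnP (m - i) N.
  rewrite (bigD1 (Ordinal mN)) //= subnKC // eqxx mulr1 big1 ?addr0.
    rewrite mulrC; congr (_ * _).
    by rewrite -{1 3}(subnKC im) Ccoef_sym.
  move=> j; rewrite -val_eqE /= => jm; rewrite [m == _]negbTE ?mulr0 //.
  by apply: contra jm => /eqP ->; rewrite addKn.
rewrite c0 // mulr0 big1 // => j _; rewrite gtn_eqF ?mulr0 //.
by rewrite -(subnKC im) ltn_add2l; apply: leq_trans (ltn_ord j) Nm.
Qed.

Lemma dcoef_iotax c n m : dcoef (iota c * x n) m = if m == n then c else 0.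
Proof. by rewrite dcoefZ dcoef_x; case: eqP; rewrite ?mulr1 ?mulr0. Qed.

Lemma x0 : x 0%N = 1.
Proof.
rewrite -[LHS]mulr1; apply: dcoef_ext => m.
by rewrite dcoef_xM leq0n Ccoefn0 mul1r subn0.
Qed.

Lemma D_ind (P : D -> Prop) : P 0 -> (forall u v, P u -> P v -> P (u + v)) ->
  (forall c n, P (iota c * x n)) -> forall d, P d.
Proof.
move=> P0 PD Px d; have [N [_ ->]] := dcoefP d.
by apply: big_ind => // i _.
Qed.

End Coefficients.

(** Homogeneous decompositions arise as lists in which degrees repeat, whereas [is_grading] and
    [submod] speak of distinct degrees; this passes from one form to the other. *)
Lemma sum_regroup (V : zmodType) (l : seq (int * V)) : \sum_(p <- l) p.2
  = \sum_(t <- undup (map fst l)) \sum_(p <- l | p.1 == t) p.2.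
Proof.
rewrite (exchange_big_dep predT) //= big_seq [RHS]big_seq; apply: eq_bigr => p pl.
rewrite (eq_bigl (fun t => t == p.1)) => [|t]; last by rewrite eq_sym.
rewrite -big_filter filter_pred1_uniq ?undup_uniq ?big_seq1 //.
by rewrite mem_undup map_f.
Qed.

(** * Graded modules, homogeneous submodules and degree-preserving maps *)

Section GradedModules.
Context {k D : comPzRingType} (iota : {rmorphism k -> D}) (x : nat -> D) (gr : bool).

Record gmod := Gmod {
  gsort :> lmodType D;
  deg : int -> gsort -> Prop;
  gmodP : gr -> is_grading iota x deg }.

(* Vacuous in the ungraded case, so that both cases are treated at once. *)
Definition hom (M : gmod) (t : int) (m : M) : Prop := gr -> deg t m.

Section Homogeneous.
Context {M : gmod}.
Implicit Types (m u v : M) (l : seq (int * M)).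

Lemma hom0 t : hom t (0 : M).
Proof. by move=> g; have [+ _] := gmodP M g. Qed.
Lemma hom_add t u v : hom t u -> hom t v -> hom t (u + v).
Proof. by move=> hu hv g; have [_ [+ _]] := gmodP M g; apply; auto. Qed.
Lemma homZ t c u : hom t u -> hom t (iota c *: u).
Proof. by move=> hu g; have [_ [_ [+ _]]] := gmodP M g; apply; auto. Qed.
Lemma homX t i u : hom t u -> hom (t + i%:Z) (x i *: u).
Proof. by move=> hu g; have [_ [_ [_ [+ _]]]] := gmodP M g; apply; auto. Qed.
Lemma hom_opp t u : hom t u -> hom t (- u).
Proof. by move=> /(homZ (-1)); rewrite rmorphN1 scaleN1r. Qed.
Lemma hom_sub t u v : hom t u -> hom t v -> hom t (u - v).
Proof. by move=> hu hv; apply: hom_add => //; apply: hom_opp. Qed.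
Lemma hom_sum (I : Type) (r : seq I) (P : pred I) (F : I -> M) t :
  (forall i, P i -> hom t (F i)) -> hom t (\sum_(i <- r | P i) F i).
Proof. by move=> h; apply: big_ind => //; [apply: hom0|move=> *; apply: hom_add]. Qed.

Lemma submod_zero : submod gr (@deg M) (fun m => m = 0).
Proof.
split=> //; split; first by move=> a u v -> ->; rewrite scaler0 addr0.
by move=> g; have [_ [_ [_ [_ [_ H]]]]] := gmodP M g.
Qed.

Lemma submod_comp (P : M -> Prop) l : submod gr (@deg M) P -> gr ->
  (forall p, p \in l -> hom p.1 p.2) -> P (\sum_(p <- l) p.2) ->
  forall t : int, P (\sum_(p <- l | p.1 == t) p.2).
Proof.
move=> [P0 [_ Pc]] g hl Pl u; have [us|us] := boolP (u \in undup (map fst l)).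
  move: Pl; rewrite sum_regroup => Pl; apply: (Pc g _ _ (undup_uniq _) _ Pl) => // t.
  rewrite -big_filter big_seq; apply: hom_sum => // p.
  by rewrite mem_filter => /andP[/eqP <- /hl].
rewrite -big_filter (_ : filter _ _ = [::]) ?big_nil //.
apply/eqP; rewrite -[_ == _]negbK -has_filter; apply: contra us => /hasP[p pl /eqP <-].
by rewrite mem_undup map_f.
Qed.

(** One decomposition inside [P] suffices: subtracting it from any other decomposition of the same
    element and taking the component of zero in degree [t] expresses [f t] by terms from [P]. *)
Lemma submod_intro (P : M -> Prop) : P 0 ->
  (forall (a : D) u v, P u -> P v -> P (a *: u + v)) ->
  (gr -> forall m, P m -> exists2 l, (forall p, p \in l -> hom p.1 p.2 /\ P p.2)
     & m = \sum_(p <- l) p.2) ->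
  submod gr (@deg M) P.
Proof.
move=> P0 PD Pd; split=> //; split=> // g s f us hf Ps t ts.
have [l hl E] := Pd g _ Ps.
pose L := [seq (i, f i) | i <- s] ++ [seq (p.1, - p.2) | p <- l].
have HL : forall p, p \in L -> hom p.1 p.2.
  move=> p; rewrite mem_cat => /orP[/mapP[i _ ->]|/mapP[q /hl [hq _] ->]] //=.
  exact: hom_opp.
have S0 : \sum_(p <- L) p.2 = 0.
  by rewrite big_cat !big_map /= E sumrN subrr.
have := submod_comp submod_zero g HL S0 t.
rewrite big_cat !big_map /= sumrN -big_filter.
rewrite (filter_pred1_uniq us ts) big_seq1 => /eqP; rewrite subr_eq0 => /eqP ->.
rewrite -big_filter big_seq; apply: big_ind => //; first by move=> u v pu pv;
  rewrite -[u]scale1r; apply: PD.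
by move=> p; rewrite mem_filter => /andP[_ /hl[]].
Qed.

End Homogeneous.

Record smod (M : gmod) := Smod {
  sset :> M -> Prop;
  smodP : submod gr (@deg M) sset }.

Section Submodules.
Context {M : gmod}.
Implicit Types (P Q R : smod M) (m u v : M).

Lemma smod_eq P Q : (forall m, P m <-> Q m) -> P = Q.
Proof.
case: P Q => [P hP] [Q hQ] /= E.
have PQ : P = Q by apply: funext => m; apply: propext.
by move: hP; rewrite PQ => hP; rewrite (Prop_irrelevance hP hQ).
Qed.

Lemma smod0 P : P 0. Proof. by have [] := smodP P. Qed.
Lemma smodZD P a u v : P u -> P v -> P (a *: u + v).
Proof. by have [_ [+ _]] := smodP P; apply. Qed.
Lemma smodD P u v : P u -> P v -> P (u + v).
Proof. by rewrite -{2}[u]scale1r; apply: smodZD. Qed.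
Lemma smodZ P a u : P u -> P (a *: u).
Proof. by move=> Pu; rewrite -[_ *: _]addr0; apply: smodZD => //; apply: smod0. Qed.
Lemma smodN P u : P u -> P (- u).
Proof. by rewrite -scaleN1r; apply: smodZ. Qed.
Lemma smodB P u v : P u -> P v -> P (u - v).
Proof. by move=> Pu Pv; apply: smodD => //; apply: smodN. Qed.
Lemma smod_sum P (I : Type) (r : seq I) (C : pred I) (F : I -> M) :
  (forall i, C i -> P (F i)) -> P (\sum_(i <- r | C i) F i).
Proof. by move=> h; apply: big_ind => //; [apply: smod0|move=> *; apply: smodD]. Qed.
Lemma smod_subr P u v : P (u - v) -> P v -> P u.
Proof. by move=> h hv; rewrite -[u](subrK v); apply: smodD. Qed.
Lemma smod_subl P u v : P (u - v) -> P u -> P v.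
Proof. by move=> h hu; rewrite -[v](subKr u); apply: smodB. Qed.
Lemma smod_subC P u v : P (u - v) -> P (v - u).
Proof. by rewrite -[v - u]opprB; apply: smodN. Qed.
Lemma smod_trans P u v w : P (u - v) -> P (v - w) -> P (u - w).
Proof. by move=> h h'; rewrite -[u](subrK v) -addrA; apply: smodD. Qed.

Lemma smod_dec P m : P m ->
  exists2 l : seq (int * M), (forall p, p \in l -> hom p.1 p.2 /\ P p.2)
    & m = \sum_(p <- l) p.2.
Proof.
move=> Pm; have [g|ng] := boolP gr; last first.
  (* Without grading [hom] is vacuous, so [m] itself with a dummy degree is a decomposition. *)
  exists [:: (0, m)]; last by rewrite big_seq1.
  by move=> p; rewrite inE => /eqP -> /=; split=> // g; rewrite g in ng.
have [_ [_ [_ [_ [/(_ m) [s [f [us hf mE]]] _]]]]] := gmodP M g.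
exists [seq (t, f t) | t <- s]; last by rewrite big_map.
move=> _ /mapP[t ts ->] /=; split=> //.
by have [_ [_ H]] := smodP P; apply: (H g s f us hf) => //; rewrite -mE.
Qed.

Definition szero : smod M := Smod submod_zero.

Lemma submod_full : submod gr (@deg M) (fun _ => True). Proof. by []. Qed.
Definition sfull : smod M := Smod submod_full.

Lemma submod_cap P Q : submod gr (@deg M) (fun m => P m /\ Q m).
Proof.
split; first by split; apply: smod0.
split; first by move=> a u v [? ?] [? ?]; split; apply: smodZD.
have [_ [_ cP]] := smodP P; have [_ [_ cQ]] := smodP Q.
by move=> g s f us hf [Ps Qs] t ts; split; [apply: (cP g s)|apply: (cQ g s)].
Qed.
Definition scap P Q : smod M := Smod (submod_cap P Q).

Lemma submod_add P Q : submod gr (@deg M) (fun m => exists u v, [/\ P u, Q v & m = u + v]).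
Proof.
apply: submod_intro; first by exists 0, 0; rewrite addr0; split=> //; apply: smod0.
  move=> a _ _ [u [v [Pu Qv ->]]] [u' [v' [Pu' Qv' ->]]].
  exists (a *: u + u'), (a *: v + v'); split; try exact: smodZD.
  by rewrite scalerDr addrACA.
move=> g _ [u [v [/smod_dec [l hl ->] /smod_dec [l' hl' ->] ->]]].
exists (l ++ l'); last by rewrite big_cat.
move=> p; rewrite mem_cat => /orP[/hl|/hl'] [hp Pp]; split=> //.
  by exists p.2, 0; rewrite addr0; split=> //; apply: smod0.
by exists 0, p.2; rewrite add0r; split=> //; apply: smod0.
Qed.
Definition sadd P Q : smod M := Smod (submod_add P Q).

Lemma saddl P Q m : P m -> sadd P Q m.
Proof. by move=> Pm; exists m, 0; rewrite addr0; split=> //; apply: smod0. Qed.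
Lemma saddr P Q m : Q m -> sadd P Q m.
Proof. by move=> Qm; exists 0, m; rewrite add0r; split=> //; apply: smod0. Qed.
Lemma sadd_lub P Q R : (forall m, P m -> R m) -> (forall m, Q m -> R m) ->
  forall m, sadd P Q m -> R m.
Proof. by move=> PR QR m [u [v [Pu Qv ->]]]; apply: smodD; auto. Qed.

End Submodules.

Record gmap (M N : gmod) := Gmap {
  gfun :> M -> N;
  gmap_lin : Dlinear gfun;
  gmap_hom : forall t m, hom t m -> hom t (gfun m) }.

Section Maps.
Context {M N : gmod} (f : gmap M N).

Lemma gmapZD a u v : f (a *: u + v) = a *: f u + f v. Proof. exact: gmap_lin. Qed.
Lemma gmap0 : f 0 = 0.
Proof. by have := gmapZD (-1) 0 0; rewrite scaler0 addr0 scaleN1r addNr. Qed.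
Lemma gmapZ a u : f (a *: u) = a *: f u.
Proof. by rewrite -[_ *: u]addr0 gmapZD gmap0 addr0. Qed.
Lemma gmapD u v : f (u + v) = f u + f v.
Proof. by rewrite -{1}[u]scale1r gmapZD scale1r. Qed.
Lemma gmap_sum (I : Type) (r : seq I) (C : pred I) (F : I -> M) :
  f (\sum_(i <- r | C i) F i) = \sum_(i <- r | C i) f (F i).
Proof. by elim/big_rec2: _ => [|i a b _ <-]; rewrite ?gmap0 ?gmapD. Qed.

Lemma submod_pre (P : smod N) : submod gr (@deg M) (fun m => P (f m)).
Proof.
split; first by rewrite gmap0; apply: smod0.
split; first by move=> a u v ? ?; rewrite gmapZD; apply: smodZD.
move=> g s F us hF; rewrite gmap_sum => Ps t ts.
have [_ [_ H]] := smodP P; apply: (H g s (f \o F) us) => // i /=.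
by apply: gmap_hom => // _.
Qed.
Definition spre P : smod M := Smod (submod_pre P).

Lemma submod_img (P : smod M) : submod gr (@deg N) (fun n => exists2 m, P m & n = f m).
Proof.
apply: submod_intro; first by exists 0; rewrite ?gmap0 //; apply: smod0.
  move=> a _ _ [u Pu ->] [v Pv ->]; exists (a *: u + v); first exact: smodZD.
  by rewrite gmapZD.
move=> g _ [m /smod_dec [l hl ->] ->].
exists [seq (p.1, f p.2) | p <- l]; last by rewrite big_map gmap_sum.
move=> _ /mapP[p /hl [hp Pp] ->] /=; split; first exact: gmap_hom.
by exists p.2.
Qed.
Definition simg P : smod N := Smod (submod_img P).

(* The degree-[t] component of any preimage of [n] is again a preimage modulo [P]. *)
Lemma hom_lift (P : smod N) (Q : smod M) t m n : hom t n -> Q m -> P (n - f m) ->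
  exists m', [/\ hom t m', Q m' & P (n - f m')].
Proof.
move=> hn /smod_dec [l hl ->] Pn; have [g|ng] := boolP gr; last first.
  exists (\sum_(p <- l) p.2); split=> //; first by move=> g; rewrite g in ng.
  by rewrite big_seq; apply: smod_sum => p /hl[].
pose L := (t, n) :: [seq (p.1, - f p.2) | p <- l].
have HL : forall p, p \in L -> hom p.1 p.2.
  move=> p; rewrite inE => /orP[/eqP ->|/mapP[q /hl [hq _] ->]] //=.
  by apply/hom_opp/gmap_hom.
have PL : P (\sum_(p <- L) p.2) by rewrite /L big_cons big_map sumrN -gmap_sum.
have := submod_comp (smodP P) g HL PL t.
rewrite /L big_cons big_map /= eqxx sumrN -gmap_sum => {}Pn.
exists (\sum_(p <- l | p.1 == t) p.2); split=> //; rewrite -big_filter big_seq.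
  by apply: hom_sum => p; rewrite mem_filter => /andP[/eqP <- /hl[]].
by apply: smod_sum => p; rewrite mem_filter => /andP[_ /hl[]].
Qed.

End Maps.

Lemma gid_subproof (M : gmod) : Dlinear (id : M -> M). Proof. by []. Qed.
Definition gid (M : gmod) : gmap M M :=
  Gmap (@gid_subproof M) (fun t m h => h).

Lemma gscale_lin (M : gmod) c : Dlinear (fun m : M => iota c *: m).
Proof. by move=> a u v; rewrite scalerDr !scalerA mulrC. Qed.
Definition gscale (M : gmod) c : gmap M M :=
  Gmap (@gscale_lin M c) (fun t m h => homZ c h).

End GradedModules.
Arguments hom {k D iota x gr M}.
Arguments szero {k D iota x gr M}.
Arguments sfull {k D iota x gr M}.

(** * Finite free modules with shifted generators *)

Section FreeModules.
Context {k D : comPzRingType} {iota : {rmorphism k -> D} } { pi : nat -> k}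
  {x : nat -> D} (HG : is_GDPA iota pi x) (gr : bool).
Local Notation coef := (dcoef HG).
Local Notation gmod := (gmod iota x gr).
Local Notation homD := (homD iota x).

Lemma homD_add t d d' : homD t d -> homD t d' -> homD t (d + d').
Proof.
move=> [->|[c [n [-> ->]]]]; first by rewrite add0r.
move=> [->|[c' [n' [[<-] ->]]]]; first by rewrite addr0; right; exists c, n.
by right; exists (c + c'), n; rewrite rmorphD mulrDl.
Qed.

Lemma homDZ t c d : homD t d -> homD t (iota c * d).
Proof.
move=> [->|[c' [n [-> ->]]]]; first by left; rewrite mulr0.
by right; exists (c * c'), n; rewrite rmorphM mulrA.
Qed.

Lemma homDX t i d : homD t d -> homD (t + i%:Z) (x i * d).
Proof.
move=> [->|[c [n [-> ->]]]]; first by left; rewrite mulr0.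
right; exists (c * Ccoef pi (i + n) n), (i + n)%N; split; first by rewrite addrC.
by rewrite mulrCA (mulxx HG) mulrA -rmorphM.
Qed.

Lemma homD_sum t (I : Type) (r : seq I) (P : pred I) F :
  (forall i, P i -> homD t (F i)) -> homD t (\sum_(i <- r | P i) F i).
Proof. by move=> h; apply: big_ind => //; [left|move=> *; apply: homD_add]. Qed.

Lemma homD_coef t d m : homD t d -> t != m%:Z -> coef d m = 0.
Proof.
move=> [->|[c [n [-> ->]]]]; first by rewrite dcoef0.
by rewrite dcoef_iotax eqz_nat eq_sym => /negPf ->.
Qed.

Lemma hom_scale (M : gmod) t s d (m : M) :
  hom t m -> homD s d -> hom (t + s) (d *: m).
Proof.
move=> hm [->|[c [n [-> ->]]]]; first by rewrite scale0r; apply: hom0.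
by rewrite -scalerA; apply/homZ/homX.
Qed.

Variables (n : nat) (dg : 'I_n -> int).

Definition free_deg (t : int) (v : 'rV[D]_n) : Prop := forall i, homD (t - dg i) (v 0 i).

Lemma row_expand (v : 'rV[D]_n) : exists N, v = \sum_(i < n) \sum_(m < N)
  (iota (coef (v 0 i) m) * x m) *: delta_mx 0 i.
Proof.
have [N HN] : exists N, forall i m, (N <= m)%N -> coef (v 0 i) m = 0.
  have H i : exists N, forall m, (N <= m)%N -> coef (v 0 i) m = 0.
    by have [N [H _]] := dcoefP HG (v 0 i); exists N.
  have [f Hf] := choice H; exists (\max_i f i)%N => i m le.
  by apply: Hf; apply: leq_trans le; apply: leq_bigmax.
exists N; rewrite {1}[v]row_sum_delta; apply: eq_bigr => i _.
by rewrite -scaler_suml {1}(dcoef_expand (HN i)).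
Qed.

Lemma delta_hom c m i : free_deg (dg i + m%:Z) ((iota c * x m) *: delta_mx 0 i).
Proof.
move=> j; rewrite !mxE eqxx /=; case: (eqVneq j i) => [->|_]; last by left; rewrite mulr0.
by right; exists c, m; rewrite mulr1 addrAC subrr add0r.
Qed.

Lemma free_grading : is_grading iota x free_deg.
Proof.
split; first by move=> t i; left; rewrite mxE.
split; first by move=> t u v hu hv i; rewrite mxE; apply: homD_add.
split; first by move=> t c u hu i; rewrite mxE; apply: homDZ.
split; first by move=> t i u hu j; rewrite mxE addrAC; apply: homDX.
split.
  move=> v; have [N vE] := row_expand v.
  pose l := flatten [seq [seq (dg i + (val m)%:Z, (iota (coef (v 0 i) m) * x m)
    *: (delta_mx 0 i : 'rV[D]_n)) | m : 'I_N] | i : 'I_n].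
  have hl p : p \in l -> free_deg p.1 p.2.
    by move=> /flattenP[_ /mapP[i _ ->] /mapP[m _ ->]]; apply: delta_hom.
  have {}vE : v = \sum_(p <- l) p.2.
    rewrite {1}vE /l big_flatten big_map big_enum; apply: eq_bigr => i _.
    by rewrite big_map big_enum.
  exists (undup (map fst l)), (fun t => \sum_(p <- l | p.1 == t) p.2); split.
  - exact: undup_uniq.
  - move=> t i; rewrite summxE -big_filter big_seq; apply: homD_sum => p.
    by rewrite mem_filter => /andP[/eqP <- /hl].
  - by rewrite -sum_regroup.
move=> s f us hf S0 t ts; apply/rowP => i; rewrite mxE; apply: (@dcoef_ext _ _ _ _ _ HG) => m.
rewrite dcoef0; have [tm|tm] := eqVneq (t - dg i) m%:Z; last exact: homD_coef (hf t i) tm.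
have /(congr1 (fun d => coef d m)) : (\sum_(t <- s) f t) 0 i = 0 by rewrite S0 mxE.
rewrite summxE dcoef_sum dcoef0 (bigD1_seq t) //= big1 ?addr0 // => u ut.
apply: homD_coef (hf u i) _; apply: contra ut => /eqP um.
by rewrite -(inj_eq (addIr (- dg i))) um tm.
Qed.

Definition gfree : gmod := @Gmod _ _ iota x gr 'rV[D]_n free_deg (fun _ => free_grading).

Lemma hom_delta i : hom (M := gfree) (dg i) (delta_mx 0 i).
Proof.
move=> _ j; rewrite !mxE eqxx /=; case: (eqVneq j i) => [->|_]; last by left.
by right; exists 1, 0%N; rewrite rmorph1 mul1r (x0 HG) subrr.
Qed.

Section Coefficientwise.
Variable I : 'I_n -> nat -> k -> Prop.
Hypothesis idealI : forall i m, is_ideal (I i m).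
Hypothesis mulI : forall i m j c, I i m c -> I i (j + m)%N (Ccoef pi (j + m) j * c).

(** Multiplication by [x j] moves the coefficient in degree [m] to degree [j + m] with factor
    [C(j+m, j)], so [mulI] expresses stability under [D]. The multiples [aF] and the residue
    filtrations are all of this form. *)
Lemma submod_coefw :
  submod gr (@deg _ _ _ _ _ gfree) (fun v : gfree => forall i m, I i m (coef (v 0 i) m)).
Proof.
apply: submod_intro; first by move=> i m; rewrite mxE dcoef0; apply: ideal0.
  move=> a u v Pu Pv i m; rewrite !mxE dcoefD; apply: idealD => //.
  elim/(D_ind HG): a => [|a b Pa Pb|c j].
  - by rewrite mul0r dcoef0; apply: ideal0.
  - by rewrite mulrDl dcoefD; apply: idealD.
  - rewrite -mulrA dcoefZ dcoef_xM; apply: idealM => //.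
    case: leqP => jm; last exact: ideal0.
    by rewrite -{1 2}(subnKC jm); apply: mulI.
move=> _ v Pv; have [N vE] := row_expand v.
exists (flatten [seq [seq (dg i + (val m)%:Z, (iota (coef (v 0 i) m) * x m)
  *: (delta_mx 0 i : 'rV[D]_n)) | m : 'I_N] | i : 'I_n]).
  move=> _ /flattenP[_ /mapP[i _ ->] /mapP[m _ ->]]; split; first by move=> _; apply: delta_hom.
  move=> j m' /=; rewrite !mxE eqxx /=; case: (eqVneq j i) => [->|_]; last first.
    by rewrite mulr0 dcoef0; apply: ideal0.
  by rewrite mulr1 dcoef_iotax; case: eqP => [->|_]; [apply: Pv|apply: ideal0].
rewrite {1}vE big_flatten big_map big_enum; apply: eq_bigr => i _.
by rewrite big_map big_enum.
Qed.

Definition scoefw : smod gfree := Smod submod_coefw.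
End Coefficientwise.

Section Comb.
Variables (M : gmod) (g : 'I_n -> M).

Definition comb (v : 'rV[D]_n) : M := \sum_(i < n) v 0 i *: g i.

Lemma comb_lin : Dlinear (M := gfree) (N := M) comb.
Proof.
move=> a u v; rewrite /comb scaler_sumr -big_split /=; apply: eq_bigr => i _.
by rewrite !mxE scalerDl scalerA.
Qed.

Hypothesis hg : forall i, hom (dg i) (g i).
Lemma comb_hom t (v : gfree) : hom t v -> hom t (comb v).
Proof.
move=> hv; apply: hom_sum => i _ G.
have -> : t = dg i + (t - dg i) by rewrite addrC subrK.
by apply: hom_scale => //; apply: hv.
Qed.
Definition gcomb : gmap gfree M := Gmap comb_lin comb_hom.
End Comb.
End FreeModules.

Section CatFun.
Definition catf (T : Type) a b (f : 'I_a -> T) (g : 'I_b -> T) (i : 'I_(a + b)) : T :=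
  match split i with inl j => f j | inr j => g j end.
Lemma catfl T a b (f : 'I_a -> T) (g : 'I_b -> T) i : catf f g (lshift b i) = f i.
Proof. by rewrite /catf (unsplitK (inl i)). Qed.
Lemma catfr T a b (f : 'I_a -> T) (g : 'I_b -> T) i : catf f g (rshift a i) = g i.
Proof. by rewrite /catf (unsplitK (inr i)). Qed.
End CatFun.

Section FreeSum.
Context {k D : comPzRingType} {iota : {rmorphism k -> D} } { pi : nat -> k}
  {x : nat -> D} (HG : is_GDPA iota pi x) (gr : bool).
Variables (a b : nat) (da : 'I_a -> int) (db : 'I_b -> int).
Local Notation F := (gfree HG gr).

Lemma inl_lin : Dlinear (M := F da) (N := F (catf da db)) (fun v => row_mx v 0).
Proof. by move=> c u v; rewrite scale_row_mx add_row_mx scaler0 addr0. Qed.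
Lemma inr_lin : Dlinear (M := F db) (N := F (catf da db)) (fun v => row_mx 0 v).
Proof. by move=> c u v; rewrite scale_row_mx add_row_mx scaler0 addr0. Qed.
Lemma prl_lin : Dlinear (M := F (catf da db)) (N := F da) (fun v => lsubmx (v : 'rV_(a + b))).
Proof. by move=> c u v; apply/rowP => i; rewrite !mxE. Qed.
Lemma prr_lin : Dlinear (M := F (catf da db)) (N := F db) (fun v => rsubmx (v : 'rV_(a + b))).
Proof. by move=> c u v; apply/rowP => i; rewrite !mxE. Qed.

Lemma inl_hom t (v : F da) : hom t v -> hom (M := F (catf da db)) t (row_mx v 0).
Proof.
move=> hv G i; case: (split_ordP i) => j ->.
  by rewrite row_mxEl catfl; apply: hv.
by rewrite row_mxEr mxE; left.
Qed.
Lemma inr_hom t (v : F db) : hom t v -> hom (M := F (catf da db)) t (row_mx 0 v).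
Proof.
move=> hv G i; case: (split_ordP i) => j ->.
  by rewrite row_mxEl mxE; left.
by rewrite row_mxEr catfr; apply: hv.
Qed.
Lemma prl_hom t (v : F (catf da db)) : hom t v -> hom (M := F da) t (lsubmx (v : 'rV_(a + b))).
Proof. by move=> hv G i; rewrite mxE -(catfl da db i); apply: hv. Qed.
Lemma prr_hom t (v : F (catf da db)) : hom t v -> hom (M := F db) t (rsubmx (v : 'rV_(a + b))).
Proof. by move=> hv G i; rewrite mxE -(catfr da db i); apply: hv. Qed.

Definition ginl : gmap (F da) (F (catf da db)) := Gmap inl_lin inl_hom.
Definition ginr : gmap (F db) (F (catf da db)) := Gmap inr_lin inr_hom.
Definition gprl : gmap (F (catf da db)) (F da) := Gmap prl_lin prl_hom.
Definition gprr : gmap (F (catf da db)) (F db) := Gmap prr_lin prr_hom.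

Lemma comb_cat (M : gmod iota x gr) (g : 'I_a -> M) (h : 'I_b -> M) (v : 'rV[D]_(a + b)) :
  comb (catf g h) v = comb g (lsubmx v) + comb h (rsubmx v).
Proof.
rewrite /comb big_split_ord /=; congr (_ + _); apply: eq_bigr => i _.
  by rewrite catfl mxE.
by rewrite catfr mxE.
Qed.
End FreeSum.

(** * Classes of subquotients, their syzygies, and modules of type [FP] *)

Section Classes.
Context {k D : comPzRingType} {iota : {rmorphism k -> D} } { pi : nat -> k}
  {x : nat -> D} (HG : is_GDPA iota pi x) (gr : bool).
Local Notation gmod := (gmod iota x gr).
Local Notation free := (gfree HG gr).

Definition sle (M : gmod) (P Q : smod M) := forall m, P m -> Q m.

(* An isomorphism [Q/P -> Q'/P'] of subquotients, given by its graph. *)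
Definition siso (M N : gmod) (P Q : smod M) (P' Q' : smod N) :=
  exists Phi : M -> N -> Prop,
  [/\ Phi 0 0 /\ (forall (a : D) m n m' n', Phi m n -> Phi m' n' ->
    Phi (a *: m + m') (a *: n + n')),
      forall m n, Phi m n -> Q m /\ Q' n,
      forall m n, Phi m n -> (P m <-> P' n),
      forall t m, Q m -> hom t m -> exists2 n, hom t n & Phi m n
    & forall t n, Q' n -> hom t n -> exists2 m, hom t m & Phi m n].

Lemma siso_sym (M N : gmod) (P Q : smod M) (P' Q' : smod N) :
  siso P Q P' Q' -> siso P' Q' P Q.
Proof.
move=> [Phi [[h0 h1] h2 h3 h4 h5]]; exists (fun n m => Phi m n); split=> //.
- by split=> // a m n m' n'; apply: h1.
- by move=> n m /h2[].
- by move=> n m /h3 ->.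
Qed.

Lemma rel_sum (M N : gmod) (Phi : M -> N -> Prop) (I : Type) (r : seq I) F G :
  Phi 0 0 -> (forall (a : D) m n m' n', Phi m n -> Phi m' n' ->
    Phi (a *: m + m') (a *: n + n')) ->
  (forall i, Phi (F i) (G i)) -> Phi (\sum_(i <- r) F i) (\sum_(i <- r) G i).
Proof.
move=> h0 h1 h; elim/big_rec2: _ => // i a b _.
by move/(h1 1 _ _ _ _ (h i)); rewrite !scale1r.
Qed.

Lemma rel_total (M N : gmod) (Phi : M -> N -> Prop) (Q : smod M) m :
  Phi 0 0 -> (forall (a : D) m n m' n', Phi m n -> Phi m' n' ->
    Phi (a *: m + m') (a *: n + n')) ->
  (forall t m, Q m -> hom t m -> exists2 n, hom t n & Phi m n) -> Q m ->
  exists2 l : seq (int * N), (forall p, p \in l -> hom p.1 p.2 /\ exists2 m, Q m & Phi m p.2)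
     & Phi m (\sum_(p <- l) p.2).
Proof.
move=> h0 h1 h /smod_dec [l + ->]; elim: l => [|p l IH] hl.
  by exists [::]; rewrite ?big_nil.
have [n hn Pn] : exists2 n, hom p.1 n & Phi p.2 n.
  by case: (hl p); rewrite ?inE ?eqxx // => hp Qp; apply: h.
have [q ql|l' hl' Pl] := IH; first by apply: hl; rewrite inE ql orbT.
exists ((p.1, n) :: l'); last first.
  by rewrite !big_cons /=; have := h1 1 _ _ _ _ Pn Pl; rewrite !scale1r.
move=> q; rewrite inE => /orP[/eqP -> /=|/hl' //]; split=> //.
by exists p.2 => //; apply: (hl p _).2; rewrite inE eqxx.
Qed.

Lemma siso_map (M N : gmod) (f : gmap M N) (P Q : smod M) (P' Q' : smod N) :
  sle P' Q' -> (forall m, Q m -> Q' (f m)) -> (forall m, Q m -> (P m <-> P' (f m))) ->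
  (forall n, Q' n -> exists2 m, Q m & P' (n - f m)) -> siso P Q P' Q'.
Proof.
(* The relation is congruence to [f m] modulo [P'] rather than equality, so that every [n] in [Q']
   has a partner even if it is not in the image of [f]. *)
move=> le' QQ PP sur; exists (fun m n => [/\ Q m, Q' n & P' (n - f m)]); split.
- split; first by rewrite gmap0 subrr; split; apply: smod0.
  move=> a m n m' n' [Qm Qn Pn] [Qm' Qn' Pn']; split; try exact: smodZD.
  by rewrite gmapZD opprD addrACA -scalerBr; apply: smodZD.
- by move=> m n [].
- move=> m n [Qm Qn Pn]; split=> [/PP Pm|Pn']; first exact: smod_subr Pn (Pm Qm).
  by apply/PP => //; apply: smod_subl Pn Pn'.
- move=> t m Qm hm; exists (f m); first exact: gmap_hom.
  by split=> //; rewrite ?subrr; [apply: QQ|apply: smod0].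
- move=> t n Qn hn; have [m Qm Pm] := sur n Qn.
  have [m' [hm' Qm' Pm']] := hom_lift hn Qm Pm.
  by exists m'.
Qed.

Definition class := forall M : gmod, smod M -> smod M -> Prop.

(** A relation [siso] tests [P'] only on elements of [Q'], so the inclusion of [P'] in [Q'] is asked
    for separately. *)
Definition iso_closed (X : class) := forall (M N : gmod) (P Q : smod M) (P' Q' : smod N),
  siso P Q P' Q' -> sle P' Q' -> X M P Q -> X N P' Q'.
Definition ext_closed (X : class) := forall (M : gmod) (P Q R : smod M),
  sle P Q -> sle Q R -> X M P Q -> X M Q R -> X M P R.
Definition closed (X : class) := iso_closed X /\ ext_closed X.

(** Some first syzygy of [Q/P] lies in [X]: the preimage of [P] is the kernel of the cover of [Q/P]
    by a finite free module. Accordingly [Res X n] says that some [n]-th syzygy lies in [X]. *)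
Definition cov (X : class) : class := fun M P Q =>
  exists n (dg : 'I_n -> int) (g : 'I_n -> M) (hg : forall i, hom (dg i) (g i)),
  [/\ forall i, Q (g i), forall m, Q m -> exists v, P (m - comb g v)
    & X (free dg) szero (spre (gcomb HG hg) P)].

Fixpoint Res (X : class) n : class := if n is n'.+1 then cov (Res X n') else X.
Arguments cov X [M] P Q.
Arguments Res X n [M] P Q.

Lemma gcomb_in (M : gmod) (Q : smod M) n (g : 'I_n -> M) v : (forall i, Q (g i)) -> Q (comb g v).
Proof. by move=> Qg; apply: smod_sum => i _; apply: smodZ. Qed.

Section Closed.
Variable X : class.
Arguments X : clear implicits.
Hypothesis cX : closed X.

Lemma X_inj (M N : gmod) (f : gmap M N) (U : smod M) (V : smod N) :
  (forall m, U m -> V (f m)) -> (forall m, U m -> f m = 0 -> m = 0) ->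
  (forall n, V n -> exists2 m, U m & n = f m) ->
  X M szero U -> X N szero V.
Proof.
move=> UV inj sur; apply: cX.1; last by move=> n ->; apply: smod0.
apply: (siso_map (f := f)) => //.
- by move=> n ->; apply: smod0.
- by move=> m Um /=; split=> [->|/inj]; [rewrite gmap0|apply].
- by move=> n /sur[m Um ->]; exists m => //=; rewrite subrr.
Qed.

Lemma X_split (M N : gmod) (f : gmap M N) (U : smod M) (V : smod N) :
  (forall m, U m -> V (f m)) -> (forall n, V n -> exists2 m, U m & n = f m) ->
  X M szero (scap U (spre f szero)) -> X N szero V -> X M szero U.
Proof.
move=> UV sur X1 X2; apply: cX.2 X1 _; first by move=> m ->; apply: smod0.
  by move=> m [].
apply: cX.1 X2; last by move=> m [].
apply/siso_sym; apply: (siso_map (f := f)) => //.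
- by move=> n ->; apply: smod0.
- by move=> m Um /=; split=> [[]|] //.
- by move=> n /sur[m Um ->]; exists m => //=; rewrite subrr.
Qed.

(** The syzygies of the joint family project to the coefficients of [h] with image [V], and the
    kernel of this projection is the syzygies of [g] alone. With [V] the syzygies modulo a larger
    submodule this gives the horseshoe lemma; with [V] the whole free module it compares two
    covers. *)
Lemma joint_r (M : gmod) (P : smod M) a b da db (g : 'I_a -> M) (h : 'I_b -> M)
  (hg : forall i, hom (da i) (g i)) (hgh : forall i, hom (catf da db i) (catf g h i))
  (V : smod (free db)) :
  (forall w, V w <-> exists v, P (comb g v + comb h w)) ->
  X (free da) szero (spre (gcomb HG hg) P) -> X (free db) szero V ->
  X (free (catf da db)) szero (spre (gcomb HG hgh) P).
Proof.
move=> VE X1; apply: (X_split (f := gprr HG gr da db)).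
- move=> u /=; rewrite comb_cat => Pu; apply/VE; by exists (lsubmx (u : 'rV_(a + b))).
- move=> w /VE[v Pv]; exists (row_mx v w); rewrite /= ?row_mxKr //.
  by rewrite comb_cat row_mxKl row_mxKr.
apply: X_inj X1; first by instantiate (1 := ginl HG gr da db);
  move=> v /= Pv; rewrite comb_cat row_mxKl row_mxKr /comb [X in _ + X]big1 ?addr0 // => i _;
    rewrite mxE scale0r.
- by move=> v _ /= /(congr1 lsubmx); rewrite row_mxKl => ->; apply/rowP => i; rewrite !mxE.
- move=> u /= [Pu r0]; exists (lsubmx (u : 'rV_(a + b))); last by rewrite -r0 hsubmxK.
  by move: Pu; rewrite /= comb_cat r0 [comb h 0]big1 ?addr0 // => i _; rewrite mxE scale0r.
Qed.

Lemma joint_l (M : gmod) (P : smod M) a b da db (g : 'I_a -> M) (h : 'I_b -> M)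
  (hh : forall i, hom (db i) (h i)) (hgh : forall i, hom (catf da db i) (catf g h i))
  (V : smod (free da)) :
  (forall v, V v <-> exists w, P (comb g v + comb h w)) ->
  X (free db) szero (spre (gcomb HG hh) P) -> X (free da) szero V ->
  X (free (catf da db)) szero (spre (gcomb HG hgh) P).
Proof.
move=> VE X1; apply: (X_split (f := gprl HG gr da db)).
- move=> u /=; rewrite comb_cat => Pu; apply/VE; by exists (rsubmx (u : 'rV_(a + b))).
- move=> v /VE[w Pv]; exists (row_mx v w); rewrite /= ?row_mxKl //.
  by rewrite comb_cat row_mxKl row_mxKr.
apply: X_inj X1; first by instantiate (1 := ginr HG gr da db);
  move=> v /= Pv; rewrite comb_cat row_mxKl row_mxKr /comb [X in X + _]big1 ?add0r // => i _;
    rewrite mxE scale0r.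
- by move=> v _ /= /(congr1 rsubmx); rewrite row_mxKr => ->; apply/rowP => i; rewrite !mxE.
- move=> u /= [Pu r0]; exists (rsubmx (u : 'rV_(a + b))); last by rewrite -r0 hsubmxK.
  by move: Pu; rewrite /= comb_cat r0 [comb g 0]big1 ?add0r // => i _; rewrite mxE scale0r.
Qed.

Lemma cov_iso : iso_closed (cov X).
Proof.
move=> M N P Q P' Q' [Phi [[h0 h1] h2 h3 h4 h5]] _ [n [dg [g [hg [Qg cg XK]]]]].
have H i : exists n, hom (dg i) n /\ Phi (g i) n.
  by have [m hm Pm] := h4 _ _ (Qg i) (hg i); exists m.
have [g' Hg'] := choice H.
have hg' i : hom (dg i) (g' i) by case: (Hg' i).
have Pc v : Phi (comb g v) (comb g' v).
  apply: rel_sum => // i; have := h1 (v 0 i) _ _ _ _ (Hg' i).2 h0.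
  by rewrite !addr0.
exists n, dg, g', hg'; split.
- by move=> i; have [_ /h2[]] := Hg' i.
- move=> m' Qm'.
  have h1' (a : D) n1 m1 n2 m2 : Phi m1 n1 -> Phi m2 n2 ->
    Phi (a *: m1 + m2) (a *: n1 + n2) by apply: h1.
  have [l _ Pl] := rel_total (Phi := fun n m => Phi m n) h0 h1' h5 Qm'.
  have [v Pv] := cg _ (h2 _ _ Pl).1; exists v.
  have := h1 (-1) _ _ _ _ (Pc v) Pl.
  by rewrite !scaleN1r [- _ + _]addrC [- _ + _]addrC => /h3 <-.
- suff -> : spre (gcomb HG hg') P' = spre (gcomb HG hg) P by [].
  by apply: smod_eq => v /=; rewrite (h3 _ _ (Pc v)).
Qed.

Lemma catf_hom (M : gmod) a b (da : 'I_a -> int) (db : 'I_b -> int) (g : 'I_a ->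
  M) (h : 'I_b -> M) :
  (forall i, hom (da i) (g i)) -> (forall i, hom (db i) (h i)) ->
  forall i, hom (catf da db i) (catf g h i).
Proof.
by move=> hg hh i; case: (split_ordP i) => j ->; rewrite ?catfl ?catfr.
Qed.

Lemma cov_ext : ext_closed (cov X).
Proof.
move=> M P Q R PQ QR [a [da [g [hg [Qg cg Xg]]]]] [b [db [h [hh [Rh ch Xh]]]]].
exists (a + b)%N, (catf da db), (catf g h), (catf_hom hg hh); split.
- by move=> i; case: (split_ordP i) => j ->; rewrite ?catfl ?catfr //; apply: QR.
- move=> m /ch[w /cg[v Pv]]; exists (row_mx v w).
  by rewrite comb_cat row_mxKl row_mxKr opprD addrCA addrC.
(* A combination of [h] lies in [Q] exactly if a combination of [g] corrects it into [P], so the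
   projection has the syzygies of [R/Q] as image. *)
- apply: joint_r Xg Xh => w /=; split=> [/cg[v Pv]|[v /PQ Pv]].
    exists (- v); suff -> : comb g (- v) = - comb g v by rewrite addrC.
    by rewrite /comb -sumrN; apply: eq_bigr => i _; rewrite mxE scaleNr.
  by rewrite -[comb h w](addKr (comb g v)) addrC; apply: smodB => //; apply: gcomb_in.
Qed.

Lemma cov_closed : closed (cov X). Proof. by split; [apply: cov_iso|apply: cov_ext]. Qed.
End Closed.

Lemma Res_closed X n : closed X -> closed (Res X n).
Proof. by move=> cX; elim: n => //= n IH; apply: cov_closed. Qed.

Lemma cov_sub (X Y : class) : (forall (M : gmod) (P Q : smod M), X M P Q -> Y M P Q) ->
  forall (M : gmod) (P Q : smod M), cov X P Q -> cov Y P Q.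
Proof. by move=> XY M P Q [n [dg [g [hg [? ? /XY ?]]]]]; exists n, dg, g, hg. Qed.

Lemma Res_sub (X Y : class) n : (forall (M : gmod) (P Q : smod M), X M P Q -> Y M P Q) ->
  forall (M : gmod) (P Q : smod M), Res X n P Q -> Res Y n P Q.
Proof. by move=> XY; elim: n => //= n IH; apply: cov_sub. Qed.

Lemma Res_cov_sub (X : class) n : (forall (M : gmod) (P Q : smod M), X M P Q -> cov X P Q) ->
  forall (M : gmod) (P Q : smod M), Res X n P Q -> Res X n.+1 P Q.
Proof.
move=> XX; elim: n => //= n IH M P Q; exact: cov_sub.
Qed.

Lemma Res_le (X : class) m n : (forall (M : gmod) (P Q : smod M), X M P Q -> cov X P Q) ->
  (m <= n)%N ->
  forall (M : gmod) (P Q : smod M), Res X m P Q -> Res X n P Q.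
Proof.
move=> XX mn M P Q H; rewrite -(subnKC mn); elim: (n - m)%N => [|e IH]; first by rewrite addn0.
by rewrite addnS; apply: Res_cov_sub.
Qed.

(* [FP n.+1 P Q]: [Q/P] has a resolution by finite free modules up to degree [n];
   so [FP 1] is finite generation and [FP 2] finite presentation. *)
Definition FP := Res (fun _ _ _ => True).
Arguments FP n [M] P Q.

Lemma FP_closed n : closed (FP n). Proof. exact: Res_closed. Qed.

Lemma FP_refl n (M : gmod) (P : smod M) : FP n P P.
Proof.
elim: n M P => //= n IH M P.
have hg (i : 'I_0) : hom 0 (0 : M) by case: i.
exists 0%N, (fun _ => 0), (fun _ => 0), hg; split; first by case.
  by move=> m Pm; exists 0; rewrite /comb big_ord0 subr0.
have -> : spre (gcomb HG hg) P = szero; last exact: IH.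
by apply: smod_eq => v /=; rewrite /comb big_ord0; split=> _; [apply: thinmx0|apply: smod0].
Qed.

Lemma comb_id n (v : 'rV[D]_n) (dg : 'I_n -> int) :
  comb (M := free dg) (fun i => delta_mx 0 i) v = v.
Proof. by rewrite [RHS]row_sum_delta. Qed.

Lemma Res_quotient_free X n r (dg : 'I_r -> int) (P : smod (free dg)) :
  Res X n szero P -> Res X n.+1 P sfull.
Proof.
move=> XP; exists r, dg, (fun i => delta_mx 0 i), (fun i => @hom_delta _ _ _ _ _ HG gr r dg i).
split=> //; first by move=> m _; exists m; rewrite comb_id subrr; apply: smod0.
suff -> : spre (gcomb HG (fun i => @hom_delta _ _ _ _ _ HG gr r dg i)) P = P by [].
by apply: smod_eq => v; rewrite [spre _ _ _]/= comb_id.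
Qed.

Lemma FP_free n r (dg : 'I_r -> int) : FP n (szero : smod (free dg)) sfull.
Proof. by case: n => // n; apply: Res_quotient_free; apply: FP_refl. Qed.

(** Generators of [Q/P] also generate [Q/S], and the syzygies modulo [S] are an extension of [S/P]
    by the syzygies modulo [P]. *)
Lemma FP_quotient n (M : gmod) (P S Q : smod M) : sle P S -> sle S Q ->
  FP n.+1 P Q -> FP n P S -> FP n.+1 S Q.
Proof.
move=> PS SQ [r [dg [g [hg [Qg cg XK]]]]] XS; exists r, dg, g, hg; split=> //.
  by move=> m /cg[v /PS]; exists v.
have [ci ce] := FP_closed n; apply: ce XK _; first by move=> m ->; apply: smod0.
  by move=> v /PS.
apply: ci XS; last by move=> v /PS.
apply: siso_sym; apply: (siso_map (f := gcomb HG hg)) => //.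
by move=> m Sm; have [v Pv] := cg _ (SQ _ Sm); exists v => //=; apply: smod_subl (PS _ Pv) Sm.
Qed.

(** The covers of [Q/P] and [Q/S] are unrelated, so the argument follows Schanuel: for the joint
    family of both sets of generators, the syzygies modulo [S] and those modulo [P] are extensions
    of a free module by the given syzygies, and the quotient of the former by the latter is
    [S/P]. *)
Lemma FP_sub n (M : gmod) (P S Q : smod M) : sle P S -> sle S Q ->
  FP n P Q -> FP n.+1 S Q -> FP n P S.
Proof.
case: n => // n PS SQ [a [da [q [hq [Qq cq Xq]]]]] [b [db [g [hg [Qg cg Xg]]]]].
pose h := catf_hom hg hq.
have combN r (u : 'I_r -> M) v : comb u (- v) = - comb u v.
  by rewrite /comb -sumrN; apply: eq_bigr => i _; rewrite mxE scaleNr.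
have X1 : FP n.+1 szero (spre (gcomb HG h) S).
  apply: (joint_r (FP_closed n.+1) h _ Xg (FP_free _ _)) => w; split=> // _.
  have [v Sv] := cg _ (gcomb_in w Qq); exists (- v); by rewrite combN addrC.
have X2 : FP n szero (spre (gcomb HG h) P).
  apply: (joint_l (FP_closed n) h _ Xq (FP_free _ _)) => w; split=> // _.
  have [v Sv] := cq _ (gcomb_in w Qg); exists (- v); by rewrite combN.
have L1 : sle szero (spre (gcomb HG h) P) by move=> v ->; apply: smod0.
have L2 : sle (spre (gcomb HG h) P) (spre (gcomb HG h) S) by move=> v /PS.
have X3 := FP_quotient L1 L2 X1 X2.
apply: (FP_closed _).1 X3 => //; apply: (siso_map (f := gcomb HG h)) => //.
move=> m Sm; have [v Pv] := cq _ (SQ _ Sm).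
have E : comb (catf g q) (row_mx 0 v) = comb q v.
  by rewrite comb_cat row_mxKl row_mxKr /comb [X in X + _]big1 ?add0r // => i _;
    rewrite mxE scale0r.
exists (row_mx 0 v); rewrite /= E //; exact: smod_subl (PS _ Pv) Sm.
Qed.

End Classes.

(** * Special filtrations and the filtration by residues modulo [h] *)

Section Special.
Context {k D : comPzRingType} {iota : {rmorphism k -> D} } { pi : nat -> k}
  {x : nat -> D} (HG : is_GDPA iota pi x) (gr : bool).
Local Notation gmod := (gmod iota x gr).
Local Notation free := (gfree HG gr).
Local Notation coef := (dcoef HG).

Definition psp (M : gmod) (P Q : smod M) := psp_quot iota pi x gr (@deg _ _ _ _ _ M) P Q.

(* The body of [psp_quot] with its witnesses exposed. *)
Definition psp_basis (M : gmod) (P Q : smod M) (h : nat) (a : k -> Prop) (sh : int)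
    (e : nat -> M) :=
  (((1 <= h)%N) /\
     (is_ideal a) /\
     (a (piv pi h)) /\
     ((forall j, Q (e j) /\ hom (sh + (h * j)%N%:Z) (e j))) /\
     ((forall (i j : nat),
          if (h %| i)%N then
            P (x i *: e j - iota (Ccoef pi (h * j + i) (h * j)) *: e (j + i %/ h)%N)
          else P (x i *: e j))) /\
     ((forall (c : k) j, a c -> P (iota c *: e j))) /\
     ((forall m, Q m -> exists (N : nat) (c : nat -> k),
          P (m - \sum_(j < N) iota (c j) *: e j))) /\
     ((forall (N : nat) (c : nat -> k), P (\sum_(j < N) iota (c j) *: e j) ->
          forall j, (j < N)%N -> a (c j)))).

Inductive spec (M : gmod) (P : smod M) : smod M -> Prop :=
| spec_refl : spec P P
| spec_cons Q R : spec P Q -> sle Q R -> psp Q R -> spec P R.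

Lemma spec_le (M : gmod) (P Q : smod M) : spec P Q -> sle P Q.
Proof. by elim=> // {}Q R _ PQ QR _ m /PQ /QR. Qed.

Lemma spec_trans (M : gmod) (P Q R : smod M) : spec P Q -> spec Q R -> spec P R.
Proof. by move=> PQ; elim=> // {}R S _ PR RS; apply: spec_cons. Qed.

Lemma psp_iso : iso_closed (fun M => @psp M).
Proof.
move=> M N P Q P' Q' [Phi [[h0 h1] h2 h3 h4 h5]] _.
move=> [h [a [sh [e [p1 [ia [ah [pe [pact [pa [psur pind]]]]]]]]]]].
have He j : exists n, hom (sh + (h * j)%N%:Z) n /\ Phi (e j) n.
  by have [Qe he] := pe j; have [n hn Pn] := h4 _ _ Qe he; exists n.
have [e' He'] := choice He.
have Pe' j := (He' j).2.
have phZ c m n : Phi m n -> Phi (c *: m) (c *: n).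
  by move=> H; have := h1 c _ _ _ _ H h0; rewrite !addr0.
have phB m n m' n' : Phi m n -> Phi m' n' -> Phi (m - m') (n - n').
  by move=> H H'; have := h1 (-1) _ _ _ _ H' H; rewrite !scaleN1r ![- _ + _]addrC.
have phS (c : nat -> k) n : Phi (\sum_(j < n) iota (c j) *: e j) (\sum_(j < n) iota (c j)
  *: e' j).
  by apply: rel_sum => // j; apply: phZ.
exists h, a, sh, e'; do !split=> //.
- by have /h2[] := Pe' j.
- by have [+ _] := He' j.
- move=> i j; have := pact i j; case: ifP => _.
    by move/(h3 _ _ (phB _ _ _ _ (phZ _ _ _ (Pe' j)) (phZ _ _ _ (Pe' _)))).
  by move/(h3 _ _ (phZ _ _ _ (Pe' j))).
- by move=> c j /(pa c j) /(h3 _ _ (phZ _ _ _ (Pe' j))).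
- move=> n Qn.
  have h1' (b : D) n1 m1 n2 m2 : Phi m1 n1 -> Phi m2 n2 ->
    Phi (b *: m1 + m2) (b *: n1 + n2) by apply: h1.
  have [l _ Pl] := rel_total (Phi := fun n m => Phi m n) h0 h1' h5 Qn.
  have [K [c Pc]] := psur _ (h2 _ _ Pl).1.
  by exists K, c; apply/(h3 _ _ (phB _ _ _ _ Pl (phS c K))).
- by move=> K c /(h3 _ _ (phS c K)) /pind.
Qed.

Lemma spec_iso : iso_closed spec.
Proof.
move=> M N P Q P' + + + sPQ; elim: sPQ => [|{}Q R sPQ IH QR pQR] R'.
  move=> [Phi [[h0 h1] h2 h3 h4 h5]] le'.
  have h1' (b : D) n1 m1 n2 m2 : Phi m1 n1 -> Phi m2 n2 ->
    Phi (b *: m1 + m2) (b *: n1 + n2) by apply: h1.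
  have -> : R' = P'; last exact: spec_refl.
  apply: smod_eq => n; split=> [Rn|/le' //].
  have [l _ Pl] := rel_total (Phi := fun n m => Phi m n) h0 h1' h5 Rn.
  by apply/(h3 _ _ Pl); have [] := h2 _ _ Pl.
move=> [Phi [[h0 h1] h2 h3 h4 h5]] le'.
have h4' t m : Q m -> hom t m -> exists2 n, hom t n & Phi m n by move=> /QR; apply: h4.
have PhB m n m' n' : Phi m n -> Phi m' n' -> Phi (m - m') (n - n').
  by move=> H H'; have := h1 (-1) _ _ _ _ H' H; rewrite !scaleN1r ![- _ + _]addrC.
(* The intermediate submodule is carried to its image under [Phi]. This is homogeneous because
   elements of [Q] decompose and each part has a partner of the same degree; the two decompositions
   may differ by an element of [P']. *)
have sub : submod gr (@deg _ _ _ _ _ N) (fun n => exists2 m, Q m & Phi m n).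
  apply: submod_intro; first by exists 0 => //; apply: smod0.
    by move=> a u v [m Qm Pm] [m' Qm' Pm']; exists (a *: m + m'); [apply: smodZD|apply: h1].
  move=> g n [m Qm Pm]; have [l hl Pl] := rel_total h0 h1 h4' Qm.
  have Pn : P' (n - \sum_(p <- l) p.2).
    apply/(h3 0); last exact: smod0.
    by have := PhB _ _ _ _ Pm Pl; rewrite subrr.
  have [l' hl' E] := smod_dec Pn; exists (l' ++ l); last by rewrite big_cat /= -E subrK.
  move=> p; rewrite mem_cat => /orP[/hl' [hp P'p]|/hl //]; split=> //.
  have [m' hm' Pm'] := h5 _ _ (le' _ P'p) hp; exists m' => //.
  by apply: (spec_le sPQ); apply/(h3 _ _ Pm').
pose Q' := Smod sub.
have P'Q' : sle P' Q'.
  move=> n /smod_dec[l hl ->]; rewrite big_seq; apply: smod_sum => p /hl[hp Pp].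
  have [m hm Pm] := h5 _ _ (le' _ Pp) hp; exists m => //.
  by apply: (spec_le sPQ); apply/(h3 _ _ Pm).
have Q'R' : sle Q' R' by move=> n [m Qm /h2[]].
apply: (spec_cons (Q := Q')) => //.
- apply: IH => //; exists (fun m n => Phi m n /\ Q m); split.
  + split; first by split=> //; apply: smod0.
    by move=> b m n m' n' [H1 Q1] [H2 Q2]; split; [apply: h1|apply: smodZD].
  + by move=> m n [Pm Qm]; split=> //; exists m.
  + by move=> m n [/h3].
  + by move=> t m Qm hm; have [n hn Pn] := h4' _ _ Qm hm; exists n.
  + move=> t n [m' Qm' Pm'] hn; have [m hm Pm] := h5 _ _ (h2 _ _ Pm').2 hn.
    exists m => //; split=> //; apply: smod_subr (_ : Q (m - m')) Qm'.
    apply: (spec_le sPQ); apply/(h3 _ 0); last exact: smod0.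
    by have := PhB _ _ _ _ Pm Pm'; rewrite subrr.
- apply: psp_iso pQR => //; exists Phi; split=> //.
  move=> m n Pm; split=> [Qm|[m' Qm' Pm']]; first by exists m.
  apply: smod_subr (_ : Q (m - m')) Qm'; apply: (spec_le sPQ); apply/(h3 _ 0); last exact: smod0.
  by have := PhB _ _ _ _ Pm Pm'; rewrite subrr.
Qed.

Lemma spec_closed : closed spec.
Proof. by split=> [|M P Q R _ _]; [apply: spec_iso|apply: spec_trans]. Qed.

Section Levels.
Variables (n : nat) (dg : 'I_n -> int) (a : k -> Prop) (f : k) (h : nat).
Hypotheses (ia : is_ideal a) (h1 : (1 <= h)%N) (ah : ideal_colon a f (piv pi h)).

(* The basis element [x m *: delta_mx 0 b] has level [lev b m]: components first,
   then decreasing residues modulo [h]. *)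
Definition lev (b m : nat) := (b * h + (h.-1 - m %% h))%N.

Lemma lev_ltn (b m : nat) : (h.-1 - m %% h < h)%N.
Proof. by apply: leq_ltn_trans (leq_subr _ _) _; rewrite prednK. Qed.

Lemma lev_div b m : (lev b m %/ h)%N = b.
Proof. by rewrite /lev divnMDl // divn_small ?addn0 // lev_ltn. Qed.

Lemma lev_mod b m : (h.-1 - lev b m %% h)%N = (m %% h)%N.
Proof.
rewrite /lev modnMDl modn_small ?lev_ltn // subKn //.
by rewrite -ltnS prednK // ltn_mod.
Qed.

Lemma lev_lt (b : 'I_n) m : (lev b m < n * h)%N.
Proof.
apply: leq_trans (_ : b.+1 * h <= _)%N; last by rewrite leq_mul2r ltn_ord orbT.
by rewrite mulSn addnC ltn_add2l lev_ltn.
Qed.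

Lemma lev_surj i : (i < n * h)%N -> exists (b : 'I_n) r, (r < h)%N /\ i = lev b r.
Proof.
move=> ilt; have b_lt : (i %/ h < n)%N by rewrite ltn_divLR.
exists (Ordinal b_lt), (h.-1 - i %% h)%N; split; first exact: lev_ltn.
rewrite /lev /= [((_ - _) %% h)%N]modn_small ?lev_ltn // subKn.
  exact: divn_eq.
by rewrite -ltnS prednK // ltn_mod.
Qed.

(** The levels are released one by one from [a] to [a + (f)], so [slev] runs from [aF] at [i = 0] to
    [(a + (f))F] at [i = n * h]. With [f = 1] it filters [F/aF]. *)
Definition lev_ideal (i : nat) (b : 'I_n) (m : nat) : k -> Prop :=
  if (lev b m < i)%N then ideal_add a f else a.

Lemma lev_is_ideal i b m : is_ideal (lev_ideal i b m).
Proof. by rewrite /lev_ideal; case: ifP => _ //; apply: is_ideal_add. Qed.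

(* The level can only grow through a carry modulo [h], and then [pi_h] divides
   the structure constant. *)
Lemma lev_mul i b m j c : lev_ideal i b m c ->
  lev_ideal i b (j + m)%N (Ccoef pi (j + m) j * c).
Proof.
rewrite /lev_ideal; case: ifP => lm; case: ifP => ljm.
- by apply: idealM; apply: is_ideal_add.
- move=> [u [r [au ->]]]; rewrite mulrDr mulrCA; apply: idealD => //; first exact: idealM.
  apply: idealM => //; rewrite Ccoef_sym.
  apply: (Ccoef_carry (a := ideal_colon a f) (h := h)) => //; first exact: is_ideal_colon.
  rewrite leqNgt; apply: contraFN ljm => nc; apply: leq_ltn_trans lm.
  have E : ((j + m) %% h = j %% h + m %% h)%N by rewrite -modnDm modn_small.
  by rewrite leq_add2l leq_sub2l // E leq_addl.
- by move=> ac; apply: idealM; [apply: is_ideal_add|apply: ideal_add_sub].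
- by move=> ac; apply: idealM.
Qed.

Definition slev i : smod (free dg) := scoefw HG gr dg (lev_is_ideal i) (@lev_mul i).

Lemma slev_le i j : (i <= j)%N -> sle (slev i) (slev j).
Proof.
move=> ij v /= H b m; have := H b m; rewrite /lev_ideal; case: ifP => [li|_].
  by rewrite (leq_trans li ij).
by case: ifP => // _; apply: ideal_add_sub.
Qed.

Section Step.
Variables (b : 'I_n) (r : nat).
Hypothesis rh : (r < h)%N.
Local Notation i0 := (lev b r).

(** The product [x r * x (h * j)] replaces the basis element [x (h * j + r)]: it differs from it by
    the factor [C(hj+r, r)], a unit modulo the colon ideal, and with this normalisation [D] acts on
    the [lev_e j] by exactly the constants with which it acts on the [x (h * j)]. *)
Definition lev_e j : free dg := (iota f * (x r * x (h * j))) *: delta_mx 0 b.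

Lemma lev_e_coef j b' m : coef (lev_e j 0 b') m =
  if (b' == b) && (m == h * j + r)%N then f * Ccoef pi (h * j + r) r else 0.
Proof.
rewrite !mxE eqxx /=; case: (eqVneq b' b) => _ /=; last by rewrite mulr0 dcoef0.
rewrite mulr1 dcoefZ (mulxx HG) dcoef_iotax [(r + _)%N]addnC; case: eqP => _;
  last by rewrite mulr0.
by rewrite addnC -Ccoef_sym.
Qed.

Lemma lev_eqP (b' : 'I_n) m : lev b' m = i0 -> b' = b /\ (m %% h)%N = r.
Proof.
move=> E; split; first by apply: val_inj; rewrite /= -(lev_div b' m) E lev_div.
by rewrite -(lev_mod b' m) E lev_mod modn_small.
Qed.

Lemma slev_stepP (v : free dg) : slev i0.+1 v ->
  slev i0 v <-> (forall m, (m %% h)%N = r -> a (coef (v 0 b) m)).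
Proof.
move=> vi; split=> [H m mr|H b' m].
  by have := H b m; rewrite /lev_ideal /lev mr (modn_small rh) ltnn.
have := vi b' m; rewrite /lev_ideal ltnS leq_eqVlt.
case: eqP => [/lev_eqP[-> mr] _|_] //=.
by rewrite /lev mr (modn_small rh) ltnn; apply: H.
Qed.

Lemma modDr j : ((h * j + r) %% h)%N = r.
Proof. by rewrite mulnC modnMDl modn_small. Qed.

Lemma lev_sum_coef N (c : nat -> k) j :
  coef ((\sum_(j < N) iota (c j) *: lev_e j) 0 b) (h * j + r)%N
    = if (j < N)%N then c j * (f * Ccoef pi (h * j + r) r) else 0.
Proof.
rewrite summxE dcoef_sum.
have E i : coef ((iota (c i) *: lev_e i) 0 b) (h * j + r)%N
    = if i == j then c j * (f * Ccoef pi (h * j + r) r) else 0.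
  rewrite mxE dcoefZ lev_e_coef eqxx eqn_add2r eqn_pmul2l // [j == i]eq_sym /=.
  by case: eqP => [->|_] //; rewrite mulr0.
under eq_bigr => i _ do rewrite E.
case: ltnP => jN; last by rewrite big1 // => i _; rewrite ltn_eqF // (leq_trans _ jN).
rewrite (bigD1 (Ordinal jN)) //= eqxx big1 ?addr0 // => i /negPf.
by rewrite -val_eqE /= => ->.
Qed.

Lemma lev_e_in j : slev i0.+1 (lev_e j).
Proof.
move=> b' m; rewrite lev_e_coef; case: andP => [[/eqP-> /eqP->]|_]; last by apply: ideal0;
  apply: lev_is_ideal.
rewrite /lev_ideal /lev modDr (modn_small rh) leqnn mulrC.
by apply: idealM; [apply: is_ideal_add|apply: ideal_add_gen].
Qed.

(** A multiple [c f] lies in [a] exactly when [c] lies in the colon ideal, and multiplication by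
    [x i] with [h] not dividing [i] leaves the residue class of [r]. So one level is a copy of
    [(D/bD)^(h)] with [b] the colon ideal, shifted by [r]. *)
Lemma slev_basis : psp_basis (slev i0) (slev i0.+1) h (ideal_colon a f)
  (dg b + r%:Z) lev_e.
Proof.
have ic := is_ideal_colon f ia; have [adm _] := HG.
have un j : unit_mod (ideal_colon a f) (Ccoef pi (h * j + r) r).
  by apply: (Ccoef_unit (h := h)) => //; apply: dvdn_mulr.
do 3!split=> //; split.
  move=> j; split; first exact: lev_e_in.
  move=> _ b'; rewrite !mxE eqxx /=; case: (eqVneq b' b) => [->|_]; last by left; rewrite mulr0.
  rewrite mulr1; apply: homDZ; right; exists (Ccoef pi (r + h * j) (h * j)), (r + h * j)%N.
  by rewrite (mulxx HG); split=> //; rewrite PoszD -!addrA addrC -!addrA addNr addr0.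
split.
  move=> i j; case: ifP => hi.
    suff -> : x i *: lev_e j - iota (Ccoef pi (h * j + i) (h * j)) *: lev_e (j + i %/ h)
      = 0 by apply: smod0.
    apply/eqP; rewrite subr_eq0 /lev_e !scalerA mulnDr [(h * (i %/ h))%N]mulnC (divnK hi).
    apply/eqP; congr (_ *: _).
    rewrite ![_ * (iota f * _)]mulrCA; congr (_ * _); rewrite mulrCA [RHS]mulrCA.
    by congr (_ * _); rewrite (mulxx HG) addnC.
  apply/slev_stepP; first exact/smodZ/lev_e_in.
  move=> m mr; rewrite mxE dcoef_xM; case: leqP => im; last exact: ideal0.
  rewrite lev_e_coef eqxx /=; case: eqP => [E|_]; last by rewrite mulr0; apply: ideal0.
  case/negP: hi; have E2 : m = (i + (h * j + r))%N by rewrite -E subnKC.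
  have : (i + (h * j + r) == 0 + (h * j + r) %[mod h])%N.
    by rewrite -E2 add0n mr modDr.
  by rewrite eqn_modDr mod0n.
split.
  move=> c j ac; apply/slev_stepP; first exact/smodZ/lev_e_in.
  move=> m mr; rewrite mxE dcoefZ lev_e_coef eqxx; case: ifP => _; last by rewrite mulr0;
    apply: ideal0.
  by rewrite mulrA; apply: idealMr.
split.
  move=> v vi; have [N [c0 _]] := dcoefP HG (v 0 b).
  (* The coefficient is [u + s f] with [u] in [a]; if [w] inverts [C(hj+r, r)] modulo the colon
     ideal, then [s w] is the coordinate along [lev_e j]. *)
  have Hc j : exists c, a (coef (v 0 b) (h * j + r)%N - c * (f * Ccoef pi (h * j + r) r)).
    have := vi b (h * j + r)%N; rewrite /lev_ideal /lev modDr (modn_small rh) leqnn.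
    move=> [u [s [au ->]]]; have [w aw] := un j; exists (s * w); rewrite -addrA;
      apply: idealD => //.
    rewrite -mulrA -mulrBr; apply: idealM => //.
    by rewrite [f * _]mulrC mulrA -{1}[f]mul1r -mulrBl.
  have [c Hc'] := choice Hc; exists N, c; apply/slev_stepP.
    apply: smodB => //; apply: smod_sum => j _; exact/smodZ/lev_e_in.
  move=> m mr; have [j ->] : exists j, m = (h * j + r)%N.
    by exists (m %/ h)%N; rewrite mulnC -mr -divn_eq.
  rewrite mxE dcoefD mxE dcoefN lev_sum_coef; case: ltnP => jN; first exact: Hc'.
  rewrite subr0 c0; first exact: ideal0.
  apply: leq_trans jN _; apply: leq_trans (leq_addr _ _); exact: leq_pmull.
move=> N c H j jN; have := (slev_stepP _).1 H => /(_ _ _ (modDr j)).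
rewrite lev_sum_coef jN => H'; apply: (unit_modP ic (un j)).
rewrite /ideal_colon mulrAC -mulrA; apply: H'.
apply: smod_sum => i _; exact/smodZ/lev_e_in.
Qed.
End Step.

Lemma slev_spec i j : (i <= j)%N -> (j <= n * h)%N -> spec (slev i) (slev j).
Proof.
move=> ij; rewrite -(subnKC ij); elim: (j - i)%N => [|e IH] le.
  by rewrite addn0; apply: spec_refl.
rewrite addnS in le *; apply: spec_cons (IH (ltnW le)) _ _; first exact: slev_le.
have [b [r [rh ->]]] := lev_surj le.
by exists h, (ideal_colon a f), (dg b + r%:Z), (lev_e b r); apply: slev_basis.
Qed.
End Levels.

End Special.

(** * Special modules have special syzygies *)

Section SpecialCovers.
Context {k D : comPzRingType} {iota : {rmorphism k -> D} } { pi : nat -> k}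
  {x : nat -> D} (HG : is_GDPA iota pi x) (gr : bool).
Local Notation gmod := (gmod iota x gr).
Local Notation free := (gfree HG gr).
Local Notation coef := (dcoef HG).
Local Notation spc := (@spec k D iota pi x gr).
Local Notation spec := (spec (pi := pi)).

(** Stated for all large [N], so that the expansions of two elements can be given a common length
    and added. *)
Lemma basis_act (M : gmod) (P : smod M) h (e : nat -> M) : (1 <= h)%N ->
  (forall i, if (h %| i)%N then P (x i *: e 0%N - e (i %/ h)%N) else P (x i *: e 0%N)) ->
  forall d : D, exists N0, forall N, (N0 <= N)%N ->
  P (d *: e 0%N - \sum_(j < N) iota (coef d (h * j)) *: e j).
Proof.
move=> h1 pact d.
elim/(D_ind HG): d => [|u v [N1 H1] [N2 H2]|c n].
- exists 0%N => N _; rewrite scale0r sub0r; apply: smodN; apply: smod_sum => j _.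
  by rewrite dcoef0 rmorph0 scale0r; apply: smod0.
- exists (maxn N1 N2) => N; rewrite geq_max => /andP[/H1 Pu /H2 Pv].
  under eq_bigr => j _ do rewrite dcoefD rmorphD scalerDl.
  by rewrite scalerDl big_split /= opprD addrACA; apply: smodD.
exists (n %/ h).+1 => N nN; rewrite -scalerA.
have := pact n; case: ifP => hn Pn.
  rewrite (bigD1 (Ordinal nN)) //= [(h * _)%N]mulnC (divnK hn) dcoef_iotax eqxx.
  rewrite big1 ?addr0; first by rewrite -scalerBr; apply: smodZ.
  move=> j; rewrite -val_eqE /= => jn; rewrite dcoef_iotax; case: eqP => [E|_].
    by rewrite -E mulKn // eqxx in jn.
  by rewrite rmorph0 scale0r.
rewrite big1 ?subr0; first exact: smodZ.
move=> j _; rewrite dcoef_iotax; case: eqP => [E|_]; last by rewrite rmorph0 scale0r.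
by rewrite -E dvdn_mulr in hn.
Qed.

Lemma psp_act0 (M : gmod) (P Q : smod M) h a sh e : psp_basis (pi := pi) P Q h a sh e ->
  forall i, if (h %| i)%N then P (x i *: e 0%N - e (i %/ h)%N) else P (x i *: e 0%N).
Proof.
by move=> [_ [_ [_ [_ [pact _]]]]] i; have := pact i 0%N;
  rewrite muln0 add0n Ccoefn0 rmorph1 scale1r add0n.
Qed.

Section IdealMultiples.
Variables (n : nat) (dg : 'I_n -> int).

Lemma const_ideal_mul a (ia : is_ideal a) (i : 'I_n) m j c : a c -> a (Ccoef pi (j + m) j * c).
Proof. by move=> ac; apply: idealM. Qed.

Definition sideal a (ia : is_ideal a) : smod (free dg) :=
  scoefw HG gr dg (I := fun _ _ => a) (fun _ _ => ia) (const_ideal_mul ia).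

Lemma sideal_eq a b (ia : is_ideal a) (ib : is_ideal b) :
  (forall c, a c <-> b c) -> sideal ia = sideal ib.
Proof. by move=> ab; apply: smod_eq => v; split=> H i m; apply/ab; apply: H. Qed.

Lemma slev0 a f h (ia : is_ideal a) (h1 : (1 <= h)%N) (ah : ideal_colon a f (piv pi h)) :
  slev HG gr dg ia h1 ah 0 = sideal ia.
Proof. by apply: smod_eq => v; split=> H i m; have := H i m. Qed.

Lemma slev_full a f h (ia : is_ideal a) (h1 : (1 <= h)%N) (ah : ideal_colon a f (piv pi h)) :
  slev HG gr dg ia h1 ah (n * h) = sideal (is_ideal_add f ia).
Proof.
by apply: smod_eq => v; split=> H i m; have := H i m; rewrite /= /lev_ideal lev_lt.
Qed.

Lemma sideal_zero (i0 : is_ideal (fun c : k => c = 0)) : szero = sideal i0.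
Proof.
apply: smod_eq => v; split=> [->|H]; first by move=> i m; rewrite mxE dcoef0.
apply/rowP => i; apply: (@dcoef_ext _ _ _ _ _ HG) => m; rewrite mxE dcoef0; exact: H.
Qed.

Fixpoint ideal_gen (s : seq k) : k -> Prop :=
  if s is f :: s' then ideal_add (ideal_gen s') f else fun c => c = 0.

Lemma is_ideal_gen s : is_ideal (ideal_gen s).
Proof.
elim: s => [|f s IH] /=; last exact: is_ideal_add.
by split=> //; split=> [a b -> ->|r a ->]; rewrite ?addr0 ?mulr0.
Qed.

Lemma ideal_genP s c : in_ideal_gen s c <-> ideal_gen s c.
Proof.
elim: s c => [|f s IH] c; first by split=> [[u ->]|->]; [|exists (fun _ => 0)]; rewrite big_ord0.
split=> [[u ->]|[a [r [/IH [u ->] ->]]]].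
  rewrite big_ord_recl addrC; exists (\sum_(i < size s) u (lift ord0 i) * s`_i), (u ord0).
  by split=> //; apply/IH; exists (fun i => u (lift ord0 i)).
exists (fun i => if unlift ord0 i is Some j then u j else r).
rewrite big_ord_recl unlift_none /= addrC; congr (_ + _).
by apply: eq_bigr => i _; rewrite liftK.
Qed.

(** Generators of the ideal are adjoined one at a time by the level filtration with [h = 1], whose
    condition on [pi_h] holds in every ideal because [pi_1 = 0]. *)
Lemma spec_ideal_gen s : spec szero (sideal (is_ideal_gen s)).
Proof.
elim: s => [|f s IH].
  by rewrite -sideal_zero; apply: spec_refl.
have a1 : ideal_colon (ideal_gen s) f (piv pi 1).
  by rewrite /ideal_colon /piv /= mul0r; exact: ideal0 (is_ideal_gen s).
apply: spec_trans IH _; rewrite -(slev0 (is_ideal_gen s) (leqnn 1) a1).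
rewrite (_ : sideal _ = slev HG gr dg (is_ideal_gen s) (leqnn 1) a1 (n * 1)).
  exact: slev_spec.
by rewrite slev_full; apply: sideal_eq.
Qed.

Lemma spec_free : spec (szero : smod (free dg)) sfull.
Proof.
have i0 := is_ideal_gen [::].
have a1 : ideal_colon (ideal_gen [::]) 1 (piv pi 1) by rewrite /ideal_colon /piv /= mul0r.
rewrite (sideal_zero i0) -(slev0 i0 (leqnn 1) a1).
rewrite (_ : sfull = slev HG gr dg i0 (leqnn 1) a1 (n * 1)); first exact: slev_spec.
rewrite slev_full; apply: smod_eq => v; split=> // _ i m.
by exists 0, (coef (v 0 i) m); split=> //; rewrite mulr1 add0r.
Qed.

Hypothesis noe : noetherian (k := k).
Lemma spec_ideal a (ia : is_ideal a) : spec szero (sideal ia).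
Proof.
have [s Hs] := noe ia; rewrite (@sideal_eq _ _ ia (is_ideal_gen s)); first exact: spec_ideal_gen.
by move=> c; rewrite Hs; apply: ideal_genP.
Qed.
End IdealMultiples.

Hypothesis noe : noetherian (k := k).

(** The quotient is cyclic on [e 0], and its annihilator consists of the elements of [D] whose
    coefficients in degrees divisible by [h] lie in [a]. Residues are released in decreasing order,
    so with [f = 1] this is level [h - 1]: all residues but 0 are free. It is special, being built
    from the multiple of [D] by [a] in [h - 1] further steps. *)
Lemma psp_cov (M : gmod) (P Q : smod M) : psp (pi := pi) P Q -> cov HG spc P Q.
Proof.
move=> [h [a [sh [e Be]]]]; have := Be.
move=> [h1 [ia [ah [pe [pact [pa [psur pind]]]]]]].
have he (i : 'I_1) : hom sh (e 0%N) by have [_] := pe 0%N; rewrite muln0 addr0.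
exists 1%N, (fun _ => sh), (fun _ => e 0%N), he.
have combE (v : 'rV[D]_1) : comb (fun _ : 'I_1 => e 0%N) v = v 0 0 *: e 0%N.
  by rewrite /comb big_ord1.
split; first by move=> i; have [] := pe 0%N.
  move=> m /psur[N [c Pc]].
  exists (\row_i \sum_(j < N) iota (c j) * x (h * j)).
  rewrite combE mxE scaler_suml; apply: smod_trans Pc _; rewrite -sumrB.
  apply: smod_sum => j _; rewrite -scalerA -scalerBr; apply/smodZ/smod_subC.
  by have := psp_act0 Be (h * j)%N; rewrite dvdn_mulr // mulKn.
have ah1 : ideal_colon a 1 (piv pi h) by rewrite /ideal_colon mulr1.
have dg1 : 'I_1 -> int := fun _ => sh.
suff -> : spre (gcomb HG he) P = slev HG gr (fun _ => sh) ia h1 ah1 h.-1.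
  apply: spec_trans (spec_ideal _ noe ia) _; rewrite -(slev0 _ ia h1 ah1).
  by apply: slev_spec => //; rewrite mul1n leq_pred.
have lt (m : nat) : (lev h 0 m < h.-1)%N = ~~ (h %| m)%N.
  rewrite /lev mul0n add0n /dvdn -lt0n; have := ltn_pmod m h1; case: (h) => // h' /=.
  case: (m %% h'.+1)%N => [|r]; first by rewrite subn0 ltnn.
  by move=> rh; rewrite ltn_subrL /= (leq_trans _ (rh : (r < h')%N)).
apply: smod_eq => v; rewrite [spre _ _ _]/= combE;
  have [N0 HN] := basis_act h1 (psp_act0 Be) (v 0 0).
have [N1 [c0 _]] := dcoefP HG (v 0 0).
pose N := maxn N0 N1; have {}HN := HN N (leq_maxl _ _); split.
  move=> Pv i m; rewrite ord1 /lev_ideal lt; case: (boolP (h %| m)%N) => [/dvdnP[j ->]|_] /=.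
    have H := pind _ (fun j => coef (v 0 0) (h * j)%N) (smod_subl HN Pv) j.
    case: (ltnP j N) => [/H|Nj]; first by rewrite mulnC.
    rewrite c0; first exact: ideal0.
    apply: leq_trans (leq_maxr N0 _) _; apply: leq_trans Nj _; exact: leq_pmulr.
  by exists 0, (coef (v 0 0) m); split; [apply: ideal0|rewrite mulr1 add0r].
move=> H; apply: smod_subr HN _; apply: smod_sum => j _; apply: pa.
by have := H 0 (h * j)%N; rewrite /lev_ideal lt dvdn_mulr.
Qed.

Lemma spec_cov (M : gmod) (P Q : smod M) : spec P Q -> cov HG spc P Q.
Proof.
elim=> [|{}Q R PQ IH QR /psp_cov pQR]; last first.
  exact: (cov_closed HG (spec_closed (pi := pi) gr)).2 (spec_le PQ) QR IH pQR.
have hg (i : 'I_0) : hom 0 (0 : M) by case: i.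
exists 0%N, (fun _ => 0), (fun _ => 0), hg; split; first by case.
  by move=> m Pm; exists 0; rewrite /comb big_ord0 subr0.
have -> : spre (gcomb HG hg) P = szero; last exact: spec_refl.
by apply: smod_eq => v /=; rewrite /comb big_ord0; split=> _; [apply: thinmx0|apply: smod0].
Qed.

Local Notation RS := (Res HG spc).

Lemma RS_closed n : closed (RS n).
Proof. exact: Res_closed (@spec_closed k D iota pi x gr). Qed.

Lemma spec_RS n (M : gmod) (P Q : smod M) : spec P Q -> RS n P Q.
Proof. exact: (Res_le spec_cov (leq0n n)). Qed.

Lemma RS_le m n (M : gmod) (P Q : smod M) : (m <= n)%N -> RS m P Q -> RS n P Q.
Proof. by move=> mn; apply: (Res_le spec_cov mn). Qed.

Lemma Res_trueS n (M : gmod) (P Q : smod M) : FP HG n.+1 P Q -> FP HG n P Q.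
Proof.
elim: n M P Q => // n IH M P Q; exact: cov_sub.
Qed.

(** The special syzygy at the end has free covers with special kernels again, so the resolution can
    be prolonged by finite free modules to any length. *)
Lemma RS_FP m n (M : gmod) (P Q : smod M) : RS m P Q -> FP HG n P Q.
Proof.
have H e : RS (m + e) P Q -> FP HG (m + e) P Q by apply: Res_sub.
move/(RS_le (leq_addr n m))/H; rewrite addnC; elim: m {H} => [|m IH]; first by rewrite addn0.
by rewrite addnS => /Res_trueS.
Qed.

End SpecialCovers.

(** * Pseudo-division by leading terms modulo a prime *)

Section Elimination.
Context {k D : comPzRingType} {iota : {rmorphism k -> D} } { pi : nat -> k}
  {x : nat -> D} (HG : is_GDPA iota pi x) (gr : bool).
Local Notation gmod := (gmod iota x gr).
Local Notation coef := (dcoef HG).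
Local Notation psp_basis := (psp_basis (pi := pi)).

Variables (M : gmod) (p : k -> Prop) (h : nat).
Hypotheses (pp : is_prime_ideal p) (h1 : (1 <= h)%N) (ph : p (piv pi h)).
Local Notation ip := (pp.1).

Section Leading.
Variables (P Q : smod M) (sh : int) (e : nat -> M).
Hypothesis PQ : psp_basis P Q h p sh e.

(* [low n v]: modulo [P], [v] is a combination of the [e j] with [j < n]. *)
Fixpoint low (n : nat) (v : M) : Prop :=
  if n is n'.+1 then exists a, low n' (v - iota a *: e n') else P v.

Lemma low_add n u v : low n u -> low n v -> low n (u + v).
Proof.
elim: n u v => [|n IH] u v /=; first exact: smodD.
by move=> [a Ha] [b Hb]; exists (a + b); rewrite rmorphD scalerDl opprD addrACA; apply: IH.
Qed.

Lemma lowZ n c v : low n v -> low n (iota c *: v).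
Proof.
elim: n v => [|n IH] v /=; first exact: smodZ.
move=> [a Ha]; exists (c * a); rewrite rmorphM -scalerA -scalerBr; exact: IH.
Qed.

Lemma low_opp n v : low n v -> low n (- v).
Proof. by move/(lowZ (-1)); rewrite rmorphN1 scaleN1r. Qed.

Lemma lowS n v : low n v -> low n.+1 v.
Proof. by exists 0; rewrite rmorph0 scale0r subr0. Qed.

Lemma low_le m n v : (m <= n)%N -> low m v -> low n v.
Proof.
move=> mn H; rewrite -(subnKC mn); elim: (n - m)%N => [|d IH]; first by rewrite addn0.
by rewrite addnS; apply: lowS.
Qed.

Lemma lowP0 n v : P v -> low n v. Proof. exact: (@low_le 0). Qed.

Lemma low_e n j : (j < n)%N -> low n (e j).
Proof.
move=> jn; apply: low_le jn _; exists 1; rewrite rmorph1 scale1r subrr.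
by apply: lowP0; apply: smod0.
Qed.

Lemma lowP n v : low n v <-> exists c : nat -> k, P (v - \sum_(j < n) iota (c j) *: e j).
Proof.
split; last first.
  move=> [c Pc]; rewrite -[v](subrK (\sum_(j < n) iota (c j) *: e j)).
  apply: low_add; first exact: lowP0.
  by apply: big_ind => [||j _]; [by apply: lowP0; apply: smod0|apply: low_add|apply/lowZ/low_e].
elim: n v => [|n IH] v /=; first by exists (fun _ => 0); rewrite big_ord0 subr0.
move=> [a /IH[c Pc]]; exists (fun j => if j == n then a else c j).
rewrite big_ord_recr /= eqxx.
rewrite (eq_bigr (fun j : 'I_n => iota (c j) *: e j)); last by move=> j _; rewrite ltn_eqF.
by rewrite opprD addrA addrAC.
Qed.

Lemma low_indep n a : low n (iota a *: e n) -> p a.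
Proof.
move=> /lowP[c Pc]; have [_ [_ [_ [_ [_ [_ [_ pind]]]]]]] := PQ.
have := pind n.+1 (fun j => if j == n then a else - c j); move=> /(_ _ n (ltnSn n)).
rewrite eqxx; apply; rewrite big_ord_recr /= eqxx addrC.
rewrite (eq_bigr (fun j : 'I_n => - (iota (c j) *: e j))); first by rewrite sumrN.
by move=> j _; rewrite ltn_eqF // rmorphN scaleNr.
Qed.

Lemma low_total v : Q v -> exists n, low n v.
Proof.
have [_ [_ [_ [_ [_ [_ [psur _]]]]]]] := PQ.
by move=> /psur[N [c Pc]]; exists N; apply/lowP; exists c.
Qed.

Lemma act_e d j : P (x (h * d)%N *: e j - iota (Ccoef pi (h * j + h * d) (h * j)) *: e (j + d)%N).
Proof.
have [_ [_ [_ [_ [pact _]]]]] := PQ.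
by have := pact (h * d)%N j; rewrite dvdn_mulr // mulKn.
Qed.

Lemma lowX n d v : low n v -> low (n + d) (x (h * d)%N *: v).
Proof.
elim: n v => [|n IH] v; first by move=> Pv; apply/lowP0/smodZ.
move=> [a /IH Ha]; rewrite addSn -[v](subrK (iota a *: e n)) scalerDr.
apply: low_add; first exact: lowS.
rewrite scalerA mulrC -scalerA; apply: lowZ.
rewrite -[_ *: _](subrK (iota (Ccoef pi (h * n + h * d) (h * n)) *: e (n + d)%N)).
by apply: low_add; [apply/lowP0/act_e|apply/lowZ/low_e].
Qed.

(** Otherwise the component of the expansion of [v] in the degree of [e n] would be [a e_n] alone,
    which would put [a] in [p]. Hence the multiples of [f] subtracted in a division automatically
    have the degree of the dividend. *)
Lemma low_deg t n v a : hom t v -> low n (v - iota a *: e n) -> ~ p a ->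
  gr -> t = sh + (h * n)%N%:Z.
Proof.
move=> hv lv pa g; apply/eqP; apply: contra_notT pa => tn.
have /lowP[c Pc] := lv.
have [_ [_ [_ [pe _]]]] := PQ.
pose c' j := if j == n then a else c j.
have {}Pc : P (v - \sum_(j < n.+1) iota (c' j) *: e j).
  rewrite big_ord_recr /= /c' eqxx.
  rewrite (eq_bigr (fun j : 'I_n => iota (c j) *: e j)); last by move=> j _; rewrite ltn_eqF.
  by rewrite opprD addrA addrAC.
pose l := (t, v) :: [seq (sh + (h * val j)%N%:Z, - (iota (c' j) *: e j)) | j : 'I_n.+1].
have hl q : q \in l -> hom q.1 q.2.
  rewrite inE => /orP[/eqP -> //|/mapP[j _ ->]] /=.
  by apply/hom_opp/homZ; have [] := pe j.
have Pl : P (\sum_(q <- l) q.2) by rewrite /l big_cons big_map big_enum /= sumrN.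
have := submod_comp (smodP P) g hl Pl (sh + (h * n)%N%:Z).
rewrite /l big_cons (negPf tn) big_map big_enum_cond /= sumrN => /smodN; rewrite opprK.
rewrite (big_pred1 (@ord_max n)) => [|j].
  by rewrite /c' eqxx => /(lowP0 n) /low_indep.
by rewrite (inj_eq (addrI _)) eqz_nat eqn_pmul2l // -val_eqE.
Qed.

End Leading.

(* The structure constants by which leading terms in degree [n] get multiplied
   stay nonzero modulo [p]. *)
Definition good_degree (n : nat) := forall d, ~ p (Ccoef pi (h * n + h * d) (h * n)).

Section MinimalLead.
Variables (P Q : smod M) (sh : int) (e : nat -> M).
Hypothesis PQ : psp_basis P Q h p sh e.
Hypothesis lePQ : sle P Q.
Local Notation low := (low P e).

Variables (W : M -> Prop) (K : smod M).
Hypothesis Wadd : forall u v, W u -> W v -> W (u + v).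
Hypothesis WZ : forall c v, W v -> W (iota c *: v).
(** The two choices of [h]: either there is no restriction and every leading term survives
    multiplication, or [W] restricts supports so that each element of [W] in [Q] is a constant
    multiple of [e 0] modulo [P]. *)
Hypothesis Wlead : (forall v, W v) /\ (forall n, good_degree n)
  \/ (forall v, W v -> Q v -> low 1 v).

Variables (f : M) (tf : int) (N : nat) (b : k).
Hypotheses (hf : hom tf f) (Kf : K f) (Wf : W f) (Qf : Q f).
Hypotheses (lf : low N (f - iota b *: e N)) (pb : ~ p b).
Hypothesis minf : forall v t, K v -> W v -> Q v -> hom t v -> low N v -> P v.

Lemma N_good : good_degree N.
Proof.
move=> d; case: Wlead => [[_ +]|L]; first by apply.
have -> : N = 0%N.
  apply/eqP; rewrite -leqn0 leqNgt; apply/negP => N0; apply: pb.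
  have fl : low N f by apply: low_le N0 _; apply: L.
  apply: (low_indep PQ (n := N)); rewrite -[_ *: _](subKr f).
  by apply: low_add => //; apply: low_opp.
by rewrite muln0 Ccoefn0; have [_ []] := pp.
Qed.

Lemma reduce g t : K g -> W g -> Q g -> hom t g ->
  exists c q, [/\ ~ p c, P (iota c *: g - q *: f), W (iota c *: g - q *: f)
    & hom t (iota c *: g - q *: f)].
Proof.
(* [W] need not be a submodule. For [n <= 1] the only multiplier that occurs is [x 0 = 1], so [W] is
   preserved in that case too. *)
have aux : forall n, (forall v, W v) \/ (n <= 1)%N -> forall g, K g -> W g -> Q g -> hom t g ->
    low n g -> exists c q, [/\ ~ p c, P (iota c *: g - q *: f), W (iota c *: g - q *: f)
    & hom t (iota c *: g - q *: f)].
  elim=> [|n IH] Hn {}g Kg Wg Qg hg lg.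
    by exists 1, 0; rewrite rmorph1 scale1r scale0r subr0; have [_ []] := pp.
  have {}IH := IH (match Hn with or_introl H => or_introl H | or_intror H => or_intror (ltnW
    H) end).
  case: (leqP n.+1 N) => [nN|Nn].
    exists 1, 0; rewrite rmorph1 scale1r scale0r subr0; split=> //; first by have [_ []] := pp.
    by apply: (minf (t := t)) => //; apply: low_le nN lg.
  have [a la] := lg.
  have [pa|pa] := pselect (p a).
    apply: IH => //; rewrite -[g](subrK (iota a *: e n)); apply: low_add => //.
    have [_ [_ [_ [_ [_ [pk _]]]]]] := PQ; exact/lowP0/pk.
  have [d nE] : exists d, n = (N + d)%N by exists (n - N)%N; rewrite subnKC.
  pose C := Ccoef pi (h * N + h * d) (h * N).
  have hx : hom t (x (h * d)%N *: f).
    move=> G; rewrite (low_deg PQ hg la pa G) nE mulnDr PoszD addrA.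
    by rewrite -(low_deg PQ hf lf pb G); apply: homX.
  have Wx : W (x (h * d)%N *: f).
    case: Hn => // n0; have d0 : d = 0%N.
      by apply/eqP; rewrite -leqn0; move: n0; rewrite ltnS nE; apply: leq_trans; apply: leq_addl.
    by rewrite d0 muln0 (x0 HG) scale1r.
  (* The leading coefficient of [x (h * d) *: f] at [e n] is [b * C], so cross-multiplication
     cancels the leading terms; [b * C] lies outside [p] by [N_good]. *)
  pose g' := iota (b * C) *: g - iota a *: (x (h * d)%N *: f).
  have WN c v : W v -> W (- (iota c *: v)).
    by move=> Wv; rewrite -scaleNr -rmorphN; apply: WZ.
  have [|||||c [q [pc Pg Wg' hg']]] := IH g'.
  - by apply: smodB; apply: smodZ => //; apply: smodZ.
  - by apply: Wadd; [apply: WZ|apply: WN].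
  - by apply: smodB; apply: smodZ => //; apply: smodZ.
  - by apply: hom_sub; apply: homZ.
  - have E1 : g' = iota (b * C) *: (g - iota a *: e n)
        - iota a *: (x (h * d)%N *: f - iota (b * C) *: e n).
      rewrite /g' !scalerBr [iota a *: (iota _ *: _)]scalerA [iota _ * iota _]mulrC -scalerA
        opprB.
      by rewrite addrA subrK.
    have E2 : x (h * d)%N *: f - iota (b * C) *: e n = x (h * d)%N *: (f - iota b *: e N)
        + iota b *: (x (h * d)%N *: e N - iota C *: e n).
      by rewrite !scalerBr !scalerA [x _ * iota b]mulrC rmorphM addrA subrK.
    rewrite E1 E2; apply: low_add; first exact: lowZ.
    apply/low_opp/lowZ/low_add; first by rewrite nE; apply: (lowX PQ).
    by apply: lowP0; apply: smodZ; rewrite nE; apply: (act_e PQ).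
  exists (c * (b * C)), (iota (c * a) * x (h * d)%N + q).
  have -> : iota (c * (b * C)) *: g - (iota (c * a) * x (h * d)%N + q)
    *: f = iota c *: g' - q *: f.
    by rewrite scalerDl opprD addrA /g' scalerBr !rmorphM -!scalerA.
  split=> //; do 2?[apply: prime_mul => //]; exact: N_good.
move=> Kg Wg Qg hg; case: Wlead => [[WT _]|L].
  have [n ln] := low_total PQ Qg; by apply: (aux n) => //; left.
by apply: (aux 1%N) => //; [right|apply: L].
Qed.

(** The multiples [x (h * j) *: f] have leading terms in the distinct degrees [N + j], with
    coefficients outside [p]; the top coefficient is peeled off by induction. *)
Lemma lead_indep c1 n (c : nat -> k) : ~ p c1 -> (forall a v, p a -> Q v -> P (iota a *: v)) ->
  P (\sum_(j < n) iota (c j) *: (x (h * j)%N *: (iota c1 *: f))) ->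
  forall j, (j < n)%N -> p (c j).
Proof.
move=> pc1 pQ; elim: n => // n IH; rewrite big_ord_recr /= => Ps.
have lf1 : low N (iota c1 *: f - iota (c1 * b) *: e N).
  by rewrite rmorphM -scalerA -scalerBr; apply: lowZ.
have lf2 : low N.+1 (iota c1 *: f) by exists (c1 * b).
pose C := Ccoef pi (h * N + h * n) (h * N).
have pcn : p (c n).
  suff : p (c n * (c1 * b * C)).
    move=> H; apply: contrapT => pcn; move: H; apply: prime_mul => //.
    by apply: prime_mul; [|apply: prime_mul|apply: N_good].
  apply: (low_indep PQ (n := (N + n)%N)).
  set T := x (h * n)%N *: (iota c1 *: f) in Ps *.
  have lT : low (N + n) (T - iota (c1 * b * C) *: e (N + n)%N).
    have -> : T - iota (c1 * b * C) *: e (N + n)%N =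
        x (h * n)%N *: (iota c1 *: f - iota (c1 * b) *: e N)
          + iota (c1 * b) *: (x (h * n)%N *: e N - iota C *: e (N + n)%N).
      rewrite scalerBr -/T [iota (c1 * b) *: (_ - _)]scalerBr.
      rewrite [x _ *: (iota (c1 * b) *: _)]scalerA [x _ * iota (c1 * b)]mulrC -scalerA.
      by rewrite addrA subrK scalerA -rmorphM.
    by apply: low_add; [apply: (lowX PQ)|apply: lowZ; apply: lowP0; apply: (act_e PQ)].
  have -> : iota (c n * (c1 * b * C)) *: e (N + n)%N =
      iota (c n) *: T - iota (c n) *: (T - iota (c1 * b * C) *: e (N + n)%N).
    by rewrite -scalerBr subKr scalerA rmorphM.
  apply: low_add; last by apply/low_opp/lowZ.
  rewrite -[_ *: T](addKr (\sum_(j < n) iota (c j) *: (x (h * j)%N *: (iota c1 *: f)))).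
  apply: low_add; last exact: lowP0.
  apply: low_opp; apply: big_ind => [||j _]; [by apply: lowP0; apply: smod0|by move=> *;
    apply: low_add|].
  apply: lowZ; apply: low_le (_ : N.+1 + j <= _)%N _; last exact: (lowX PQ).
  by rewrite addSnnS leq_add2l.
move=> j; rewrite ltnS leq_eqVlt => /orP[/eqP -> //|]; apply: IH.
rewrite -[X in P X](addrK (iota (c n) *: (x (h * n)%N *: (iota c1 *: f)))).
by apply: smodB => //; apply: pQ => //; do 2!apply: smodZ.
Qed.

Lemma act_nondiv m v : ~~ (h %| m)%N -> Q v -> P (x m *: v).
Proof.
have [_ [_ [_ [_ [pact [_ [psur _]]]]]]] := PQ.
move=> hm /psur[n [c Pc]]; rewrite -[v](subrK (\sum_(j < n) iota (c j) *: e j)) scalerDr.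
apply: smodD; first exact: smodZ.
rewrite scaler_sumr; apply: smod_sum => j _; rewrite scalerA mulrC -scalerA; apply: smodZ.
by have := pact m j; rewrite (negPf hm).
Qed.

(** The new quotient is cyclic on [c1 f]. For [m = hj + r] with [0 < r < h], [x m] is modulo [p] a
    multiple of [x (h * j) * x r], as [C(hj+r, r)] is a unit there; so killing the finitely many
    [x r] with [0 < r < h] kills all [x m] with [h] not dividing [m]. Independence modulo [K1]
    follows from independence modulo the larger [P]. *)
Lemma adjoin_lead (E0 K1 : smod M) c1 : sle E0 K1 -> sle K1 P ->
  (forall a v, p a -> Q v -> E0 (iota a *: v)) -> ~ p c1 ->
  (forall m, (0 < m < h)%N -> K1 (iota c1 *: (x m *: f))) ->
  exists K' : smod M, [/\ psp (pi := pi) K1 K', sle K1 K'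
    & forall v, K' v <-> exists u d, K1 u /\ v = u + d *: (iota c1 *: f)].
Proof.
move=> E1 le1 pE pc1 Hx; set f1 := iota c1 *: f.
have hf1 (i : 'I_1) : hom tf f1 by apply: homZ.
have K'P v : sadd K1 (simg (gcomb HG hf1) sfull) v <-> exists u d, K1 u /\ v = u + d *: f1.
  split=> [[u [_ [K1u [w _ ->] ->]]]|[u [d [K1u ->]]]].
    by exists u, (w 0 0); rewrite /= /comb big_ord1.
  exists u, (d *: f1); split=> //; exists (\row_i d) => //=.
  by rewrite /comb big_ord1 mxE.
exists (sadd K1 (simg (gcomb HG hf1) sfull)); split=> //; last by move=> v; apply: saddl.
have Qf1 : Q f1 by apply: smodZ.
have nondiv m : ~~ (h %| m)%N -> K1 (x m *: f1).
  move=> hm; have [adm _] := HG.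
  pose r := (m %% h)%N; pose j := (m %/ h)%N.
  have mE : m = (h * j + r)%N by rewrite mulnC -divn_eq.
  have rh : (r < h)%N by rewrite ltn_mod.
  have r0 : (0 < r)%N by rewrite lt0n.
  have [u pu] : unit_mod p (Ccoef pi (h * j + r) r).
    by apply: (Ccoef_unit (h := h)) => //; [exact: ip|apply: dvdn_mulr].
  have -> : x m *: f1 = iota (1 - u * Ccoef pi (h * j + r) r) *: (x m *: f1)
      + (iota u * x (h * j)%N) *: (iota c1 *: (x r *: f)).
    rewrite [iota c1 *: _]scalerA [iota c1 * _]mulrC -[(x r * _) *: _]scalerA -/f1.
    rewrite [(iota u * _) *: _]scalerA -[iota u * _ * _]mulrA (mulxx HG) -mE.
    by rewrite rmorphB rmorph1 rmorphM scalerBl scale1r mulrA [(iota u * iota _)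
      *: _]scalerA subrK.
  apply: smodD; first by apply: E1; apply: pE => //; apply: smodZ.
  by apply: smodZ; apply: Hx; rewrite r0.
pose e' j := x (h * j)%N *: f1.
have e'0 : e' 0%N = f1 by rewrite /e' muln0 (x0 HG) scale1r.
have act0 i : if (h %| i)%N then K1 (x i *: e' 0%N - e' (i %/ h)%N) else K1 (x i *: e' 0%N).
  case: ifP => hi; last by rewrite e'0; apply: nondiv; rewrite hi.
  by rewrite e'0 /e' mulnC (divnK hi) subrr; apply: smod0.
have ip' : is_ideal p := ip.
exists h, p, tf, e'; do 3!split=> //; split.
  move=> j; split; last exact: (homX (h * j) (hf1 ord0)).
  by apply/K'P; exists 0, (x (h * j)%N); rewrite add0r; split=> //; apply: smod0.
split.
  move=> i j; case: ifP => hi.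
    rewrite /e' !scalerA (mulxx HG) mulnDr [(h * (i %/ h))%N]mulnC (divnK hi) addnC.
    by rewrite subrr; apply: smod0.
  rewrite /e' scalerA (mulxx HG) -scalerA; apply: smodZ; apply: nondiv.
  by rewrite dvdn_addl ?dvdn_mulr // hi.
split; first by move=> c j pc; apply: E1; apply: pE => //; apply: smodZ.
split.
  move=> _ /K'P[u [d [K1u ->]]]; have [n /(_ n (leqnn n))] := basis_act HG h1 act0 d.
  rewrite e'0 => Hd; exists n, (fun j => coef d (h * j)%N).
  by rewrite -addrA; apply: smodD.
move=> n c /le1; apply: lead_indep => //.
by move=> a v pa Qv; apply: le1; apply: E1; apply: pE.
Qed.

End MinimalLead.

Variable W : M -> Prop.
Hypothesis Wadd : forall u v, W u -> W v -> W (u + v).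
Hypothesis WZ : forall c v, W v -> W (iota c *: v).
Hypothesis WX : forall m v, (m < h)%N -> W v -> W (x m *: v).

Inductive lead_chain (E0 : smod M) : smod M -> Prop :=
| lead_nil : lead_chain E0 E0
| lead_cons P Q sh e : lead_chain E0 P -> sle P Q -> psp_basis P Q h p sh e ->
    ((forall v, W v) /\ (forall n, good_degree n) \/ (forall v, W v -> Q v -> low P e 1 v)) ->
    lead_chain E0 Q.

Lemma not_prime_prod (I : eqType) (r : seq I) (c : I -> k) :
  (forall i, i \in r -> ~ p (c i)) -> ~ p (\prod_(i <- r) c i).
Proof.
move=> H; rewrite big_seq; apply: (big_ind (fun c => ~ p c)) => //; first by have [_ []] := pp.
by move=> *; apply: prime_mul.
Qed.

(* Gaussian elimination with denominators outside [p]: at the top level of the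
   chain, pseudo-divide all generators by one of minimal leading degree. *)
Lemma elimination E0 E : lead_chain E0 E ->
  (forall a v, p a -> E v -> E0 (iota a *: v)) ->
  forall l : seq M, (forall v, v \in l -> [/\ W v, E v & exists t, hom t v]) ->
  forall K : smod M, sle E0 K -> (forall v, v \in l -> K v) ->
  exists K' : smod M, [/\ sle K' K, sle K' E, spec (pi := pi) E0 K'
    & exists c, ~ p c /\ forall v, v \in l -> K' (iota c *: v)].
Proof.
elim=> [|P Q sh e cP IH lePQ PQ HW] pE l hl K EK Kl.
  exists E0; split=> //; first exact: spec_refl.
  exists 1; split; first by have [_ []] := pp.
  by move=> v /hl[_ Ev _]; apply: smodZ.
have pE' a v : p a -> P v -> E0 (iota a *: v) by move=> pa /lePQ; apply: pE.
(* If no [n] qualifies, the generators already lie in [P] and this step of the chain contributes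
   nothing. Otherwise the least [n] is some [N.+1], since [low] at 0 is membership in [P], and its
   witness [f] is the divisor. *)
pose A n := exists v t, [/\ K v, W v, Q v, hom t v & ~ P v /\ low P e n v].
have [[n0 An0]|nA] := pselect (exists n, A n); last first.
  have [|K' [K'K K'P sp [c [pc Hc]]]] := IH pE' l _ K EK Kl.
    move=> v vl; have [Wv Qv [t hv]] := hl v vl; split=> //; last by exists t.
    apply: contrapT => nP; apply: nA; have [n ln] := low_total PQ Qv.
    by exists n, v, t; split=> //; apply: Kl.
  by exists K'; split=> //; [move=> v /K'P /lePQ|exists c].
have [n /asboolP An minn] := ex_minnP (ex_intro (fun n => `[< A n >]) n0 (asboolT An0)).
have {}minn m v t : (m < n)%N -> K v -> W v -> Q v -> hom t v -> low P e m v -> P v.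
  move=> mn Kv Wv Qv hv lv; apply: contrapT => nP.
  have /minn : `[< A m >] by apply/asboolP; exists v, t.
  by rewrite leqNgt mn.
have [f [tf [Kf Wf Qf hf [nPf lf]]]] := An.
case: n An minn lf => [|N] An minn lf; first by case: nPf.
have [b lfb] := lf.
have pb : ~ p b.
  move=> pb; apply: nPf; apply: (minn N f tf) => //.
  rewrite -[f](subrK (iota b *: e N)); apply: low_add => //.
  have [_ [_ [_ [_ [_ [pk _]]]]]] := PQ; by apply: lowP0; apply: pk.
have minf v t : K v -> W v -> Q v -> hom t v -> low P e N v -> P v by apply: minn.
have Hred g : exists cq : k * D, g \in l -> [/\ ~ p cq.1, P (iota cq.1 *: g - cq.2 *: f),
    W (iota cq.1 *: g - cq.2 *: f) & exists t, hom t (iota cq.1 *: g - cq.2 *: f)].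
  have [gl|] := boolP (g \in l); last by exists (0, 0).
  have [Wg Qg [t hg]] := hl g gl.
  have [c [q [? ? ? ?]]] := reduce PQ Wadd WZ HW hf Kf Wf Qf lfb pb minf (Kl g gl) Wg Qg hg.
  by exists (c, q) => _; split=> //; exists t.
have [cq Hcq] := choice Hred.
(* Besides the remainders, the list passed down contains the products [x m *: f] with [0 < m < h].
   They fall into [P], and must be absorbed by [K1] for the adjoined quotient to be of type
   [(h)]. *)
pose l1 := [seq iota (cq g).1 *: g - (cq g).2 *: f | g <- l] ++ [seq x m *: f | m <- seq.iota
  1 h.-1].
have hl1 v : v \in l1 -> [/\ W v, P v & exists t, hom t v].
  rewrite mem_cat => /orP[/mapP[g /Hcq[_ Pg Wg hg] ->]|/mapP[m mh ->]] //.
  move: mh; rewrite mem_iota add1n prednK // => /andP[m0 mh]; split.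
  - exact: WX.
  - by apply: (act_nondiv PQ) => //; rewrite gtnNdvd.
  - by exists (tf + m%:Z); apply: homX.
have Kl1 v : v \in l1 -> K v.
  rewrite mem_cat => /orP[/mapP[g gl ->]|/mapP[m _ ->]]; last exact: smodZ.
  by apply: smodB; apply: smodZ => //; apply: Kl.
have [K1 [K1K K1P sp1 [c1 [pc1 Hc1]]]] := IH pE' l1 hl1 K EK Kl1.
have Hx m : (0 < m < h)%N -> K1 (iota c1 *: (x m *: f)).
  move=> mh; apply: Hc1; rewrite mem_cat; apply/orP; right; apply: map_f.
  by rewrite mem_iota add1n prednK.
have [K' [pK' K1K' K'P]] := adjoin_lead PQ HW hf Wf Qf lfb pb (spec_le sp1) K1P pE pc1 Hx.
exists K'; split.
- move=> _ /K'P[u [d [/K1K Ku ->]]]; apply: smodD => //; do 2!apply: smodZ; exact: Kf.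
- move=> _ /K'P[u [d [/K1P /lePQ Pu ->]]]; apply: smodD => //; do 2!apply: smodZ; exact: Qf.
- exact: spec_cons sp1 K1K' pK'.
(* A common denominator: the multiplier of each pseudo-division times the one from the lower
   level. *)
exists (c1 * \prod_(g <- l) (cq g).1); split.
  by apply: prime_mul => //; apply: not_prime_prod => g /Hcq[].
move=> g gl; rewrite (perm_big _ (perm_to_rem gl)) big_cons.
have -> : iota (c1 * ((cq g).1 * \prod_(j <- rem g l) (cq j).1)) *: g
    = iota (\prod_(j <- rem g l) (cq j).1) *: (iota c1 *: (iota (cq g).1 *: g)).
  by rewrite !scalerA -!rmorphM mulrA mulrC mulrA.
apply: smodZ; apply/K'P; exists (iota c1 *: (iota (cq g).1 *: g - (cq g).2 *: f)), (cq g).2;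
  split.
  by apply: Hc1; rewrite mem_cat; apply/orP; left; apply/mapP; exists g.
by rewrite scalerBr !scalerA [iota c1 * (cq g).2]mulrC subrK.
Qed.

End Elimination.

(** * Elimination in a free module modulo a prime of [k] *)

Section PrimeStep.
Context {k D : comPzRingType} {iota : {rmorphism k -> D} } { pi : nat -> k}
  {x : nat -> D} (HG : is_GDPA iota pi x) (gr : bool).
Local Notation coef := (dcoef HG).
Variables (n : nat) (dg : 'I_n -> int) (p : k -> Prop).
Hypothesis pp : is_prime_ideal p.
Local Notation F := (gfree HG gr dg).
Local Notation pF := (sideal HG gr dg pp.1).

Lemma sideal_kill c (v : F) : p c -> pF (iota c *: v).
Proof. by move=> pc i m; rewrite mxE dcoefZ; apply: idealMr => //; exact: pp.1. Qed.

Lemma support_bound (l : seq F) : exists N, forall v, v \in l ->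
  forall i m, (N <= m)%N -> coef (v 0 i) m = 0.
Proof.
elim: l => [|v l [N HN]]; first by exists 0%N.
have H i : exists N, forall m, (N <= m)%N -> coef (v 0 i) m = 0.
  by have [N' [H _]] := dcoefP HG (v 0 i); exists N'.
have [f Hf] := choice H; exists (maxn N (\max_i f i)) => u.
rewrite inE => /orP[/eqP ->|ul] i m; rewrite geq_max => /andP[Nm fm]; last exact: HN.
by apply: Hf; apply: leq_trans fm; apply: leq_bigmax.
Qed.

Section Chain.
Variable h : nat.
Hypotheses (h1 : (1 <= h)%N) (ph : p (piv pi h)).
Variable W : F -> Prop.

Lemma colon1 : ideal_colon p 1 = p.
Proof. by apply: funext => c; rewrite /ideal_colon mulr1. Qed.

Lemma colon_pi : ideal_colon p 1 (piv pi h). Proof. by rewrite colon1. Qed.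

Local Notation E := (slev HG gr dg pp.1 h1 colon_pi).

Lemma residue_chain :
  (forall (b : 'I_n) r, (r < h)%N ->
    (forall v, W v) /\ (forall j, good_degree (pi := pi) p h j)
    \/ (forall v, W v -> E (lev h b r).+1 v ->
      low (E (lev h b r)) (lev_e HG gr dg 1 h b r) 1 v)) ->
  lead_chain (pi := pi) p h W pF sfull.
Proof.
move=> HW.
have -> : sfull = E (n * h).
  rewrite slev_full; apply: smod_eq => v; split=> // _ i m.
  by exists 0, (coef (v 0 i) m); rewrite mulr1 add0r; split=> //; apply: ideal0; exact: pp.1.
suff H i : (i <= n * h)%N -> lead_chain (pi := pi) p h W pF (E i) by apply: H.
elim: i => [|i IH] le; first by rewrite slev0; apply: lead_nil.
have [b [r [rh iE]]] := lev_surj h1 le.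
apply: (lead_cons (P := E i) (sh := dg b + r%:Z) (e := lev_e HG gr dg 1 h b r));
  first exact: IH (ltnW le).
- exact: slev_le.
- by rewrite iE; have := slev_basis HG gr dg pp.1 h1 colon_pi b rh; rewrite colon1.
- by rewrite iE; apply: HW.
Qed.
End Chain.

(* If the indices [t] with [pi_t] in [p] are bounded, take for [h] the largest one;
   otherwise take one beyond the support of all generators. *)
Lemma prime_step (l : seq F) (K : smod F) : sle pF K ->
  (forall v, v \in l -> K v /\ exists t, hom t v) ->
  exists K' : smod F, [/\ sle K' K, spec (pi := pi) pF K'
    & exists c, ~ p c /\ forall v, v \in l -> K' (iota c *: v)].
Proof.
move=> pK lK; have [adm _] := HG.
have [[B HB]|nB] := pselect (exists B, forall t, (1 <= t)%N -> p (piv pi t) -> (t <= B)%N).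
  (* The maximum is over a nonempty set because [pi_1 = 0]. *)
  have ex1 : exists t, `[< (1 <= t)%N /\ p (piv pi t) >].
    by exists 1%N; apply/asboolP; split=> //; apply: ideal0; exact: pp.1.
  have bd t : `[< (1 <= t)%N /\ p (piv pi t) >] -> (t <= B)%N by move=> /asboolP[]; apply: HB.
  have [h /asboolP[h1 ph] hmax] := ex_maxnP ex1 bd.
  have Hg j : good_degree (pi := pi) p h j.
    move=> d; rewrite Ccoef_sym; apply: (Ccoef_nprime adm pp h1 ph) => [t t1 pt|].
      by apply: hmax; apply/asboolP.
    exact: dvdn_mulr.
  have ch : lead_chain (pi := pi) p h (fun _ : F => True) pF sfull.
    by apply: residue_chain => // b r _; left.
  have pE a v : p a -> sfull v -> pF (iota a *: v) by move=> pa _; apply: sideal_kill.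
  have hl v : v \in l -> [/\ True, (sfull : smod F) v & exists t, hom t v] by move=> /lK[_ ht].
  have Kl v : v \in l -> K v by move=> /lK[].
  have [//|//|//|K' [K'K _ sp Hc]] := elimination HG pp h1 ph _ _ _ ch pE hl pK Kl.
  by exists K'.
have [N HN] := support_bound l.
have [h [h1 ph Nh]] : exists h, [/\ (1 <= h)%N, p (piv pi h) & (N <= h)%N].
  apply: contrapT => H; apply: nB; exists N => t t1 pt; rewrite leqNgt; apply/negP => Nt.
  by apply: H; exists t; split=> //; apply: ltnW.
(* Modulo [p] such a vector has at most one coefficient per component and residue class, namely in a
   degree below [h]; at each level it is therefore a constant multiple of [lev_e] at [j = 0]. *)
pose W (v : F) := forall i m, (h <= m)%N -> p (coef (v 0 i) m).
have ip := pp.1.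
have ch : lead_chain (pi := pi) p h W pF sfull.
  refine (@residue_chain h h1 ph W _) => b r rh; right=> v Wv Ev.
  exists (coef (v 0 b) r); have e0 := lev_e_in HG gr dg pp.1 h1 (colon_pi ph) b rh 0.
  apply/(slev_stepP rh (smodB Ev (smodZ _ e0))).
  move=> m mr; rewrite mxE dcoefD mxE dcoefN mxE dcoefZ lev_e_coef //.
  rewrite eqxx muln0 add0n mul1r /=; case: eqP => [->|/eqP nmr].
    have := Ccoef_sym pi 0 r; rewrite add0n Ccoefn0 => <-.
    by rewrite mulr1 subrr; apply: ideal0.
  rewrite mulr0 subr0; apply: Wv; rewrite leqNgt; apply: contra nmr => mh.
  by rewrite -mr modn_small.
have Wadd u v : W u -> W v -> W (u + v).
  by move=> Wu Wv i m hm; rewrite mxE dcoefD; apply: idealD; [|apply: Wu|apply: Wv].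
have WZ c v : W v -> W (iota c *: v).
  by move=> Wv i m hm; rewrite mxE dcoefZ; apply: idealM; [|apply: Wv].
(* A product of two degrees below [h] that reaches degree [h] carries, so its structure constant
   lies in [p]. *)
have WX m v : (m < h)%N -> W v -> W (x m *: v).
  move=> mh Wv i j hj; rewrite mxE dcoef_xM; have mj := leq_trans (ltnW mh) hj.
  rewrite mj; have [hd|dh] := leqP h (j - m); first by apply: idealM => //; apply: Wv.
  apply: idealMr => //; rewrite -{1}(subnK mj).
  by apply: (Ccoef_carry ip h1 ph); rewrite !modn_small // subnK.
have pE a v : p a -> sfull v -> pF (iota a *: v) by move=> pa _; apply: sideal_kill.
have hl v : v \in l -> [/\ W v, (sfull : smod F) v & exists t, hom t v].
  move=> vl; have [_ ht] := lK v vl; split=> // i m hm.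
  by rewrite (HN v vl) ?(leq_trans Nh) //; apply: ideal0.
have Kl v : v \in l -> K v by move=> /lK[].
have [K' [K'K _ sp Hc]] := elimination HG pp h1 ph Wadd WZ WX ch pE hl pK Kl.
by exists K'.
Qed.
End PrimeStep.

(** * Noetherian induction on the annihilating ideal *)

Section Finiteness.
Context {k D : comPzRingType} {iota : {rmorphism k -> D} } { pi : nat -> k}
  {x : nat -> D} (HG : is_GDPA iota pi x) (gr : bool).
Hypothesis noe : noetherian (k := k).
Local Notation gmod := (gmod iota x gr).
Local Notation coef := (dcoef HG).
Local Notation RS := (Res HG (@spec k D iota pi x gr)).
Local Notation FP := (FP HG).

(* For [a = 0] and [d = d'.+1] this says that [k] has dimension at most [d']. *)
Definition chain_bound (a : k -> Prop) (d : nat) :=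
  forall n q, prime_chain n q -> (forall c, a c -> q 0%N c) -> (n < d)%N.

Definition killed (a : k -> Prop) (M : gmod) (P Q : smod M) :=
  forall c v, a c -> Q v -> P (iota c *: v).

Lemma FP_scale (M : gmod) (P Q : smod M) c :
  FP 1 P Q -> FP 1 P (sadd P (simg (gscale M c) Q)).
Proof.
move=> [n [dg [g [hg [Qg cg _]]]]].
exists n, dg, (fun i => iota c *: g i), (fun i => homZ c (hg i)); split=> //.
  by move=> i; apply: saddr; exists (g i).
move=> _ [u [_ [Pu [v Qv ->] ->]]]; have [w Pw] := cg v Qv; exists w.
have -> : comb (fun i => iota c *: g i) w = iota c *: comb g w.
  rewrite /comb scaler_sumr; apply: eq_bigr => i _.
  by rewrite !scalerA mulrC.
by rewrite -addrA /= -scalerBr; apply: smodD => //; apply: smodZ.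
Qed.

(** In [chain_bound] the number [d] bounds the primes of a chain above [a], not its strict
    inclusions; this is the origin of [d + 1] in the theorem. *)
Definition finite_sd (a : k -> Prop) := forall (M : gmod) (P Q : smod M),
  sle P Q -> killed a P Q -> FP 2 P Q ->
  (exists n, RS n P Q) /\ (forall d, chain_bound a d -> RS d P Q).

Lemma finite_sd_FP a (M : gmod) (P Q : smod M) n : finite_sd a ->
  sle P Q -> killed a P Q -> FP 2 P Q -> FP n P Q.
Proof. by move=> H PQ kPQ fPQ; have [[m Hm] _] := H M P Q PQ kPQ fPQ;
  apply: (RS_FP noe n Hm). Qed.

Lemma RS_ext n (M : gmod) (P Q R : smod M) : sle P Q -> sle Q R -> RS n P Q -> RS n Q R ->
  RS n P R.
Proof. exact: (RS_closed HG gr n).2. Qed.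

Lemma chain_bound_add a f d : is_ideal a -> chain_bound a d -> chain_bound (ideal_add a f) d.
Proof. by move=> ia H n q cq aq; apply: (H n q cq) => c /(ideal_add_sub f ia) /aq. Qed.

Lemma finite_sd_nonprime a b c : is_ideal a -> a (b * c) ->
  finite_sd (ideal_add a b) -> finite_sd (ideal_add a c) -> finite_sd a.
Proof.
move=> ia abc Hb Hc M P Q PQ kPQ fPQ.
pose S := sadd P (simg (gscale M b) Q).
have PS : sle P S by move=> m; apply: saddl.
have SQ : sle S Q by apply: sadd_lub => // m [v Qv ->]; apply: smodZ.
have kSQ : killed (ideal_add a b) S Q.
  move=> _ v [u [r [au ->]]] Qv; rewrite rmorphD rmorphM scalerDl -scalerA.
  by apply: smodD; [apply/PS/kPQ|apply: smodZ; apply: saddr; exists v].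
have kPS : killed (ideal_add a c) P S.
  move=> _ _ [u [r [au ->]]] [v [_ [Pv [w Qw ->] ->]]].
  rewrite scalerDr; apply: smodD; first exact: smodZ.
  rewrite /= rmorphD rmorphM scalerDl; apply: smodD; first by apply: kPQ => //; apply: smodZ.
  rewrite scalerA -mulrA -rmorphM [c * b]mulrC -scalerA; apply: smodZ; exact: kPQ.
have fSQ : FP 2 S Q := FP_quotient PS SQ fPQ (FP_scale b (Res_trueS fPQ)).
(* The quotient [Q/S] is treated first: being killed by a larger ideal it is of type [FP 3] by
   induction, and this makes the kernel [S/P] finitely presented. *)
have fPS : FP 2 P S := FP_sub PS SQ fPQ (finite_sd_FP 3 Hb SQ kSQ fSQ).
have [[n1 H1] B1] := Hb _ _ _ SQ kSQ fSQ; have [[n2 H2] B2] := Hc _ _ _ PS kPS fPS.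
split.
  exists (maxn n1 n2); apply: (RS_ext PS SQ).
    by apply: (RS_le noe (leq_maxr _ _) H2).
  by apply: (RS_le noe (leq_maxl _ _) H1).
by move=> d Hd; apply: (RS_ext PS SQ); [apply: B2|apply: B1]; apply: chain_bound_add.
Qed.

Lemma prime_chain_cons (p : k -> Prop) n (q : nat -> k -> Prop) : is_prime_ideal p ->
  prime_chain n q ->
  (forall c, p c -> q 0%N c) -> (exists2 c, q 0%N c & ~ p c) ->
  prime_chain n.+1 (fun i => if i is j.+1 then q j else p).
Proof.
move=> pp [qp qs] pq [c qc pc]; split=> [[|i] //|[|i]]; first exact: qp.
  by move=> _; split=> //; exists c.
exact: qs.
Qed.

Lemma finite_sd_prime p : is_prime_ideal p ->
  (forall c, ~ p c -> finite_sd (ideal_add p c)) -> finite_sd p.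
Proof.
move=> pp IH M P Q PQ kPQ [n [dg [g [hg [Qg cg fK]]]]].
pose F := gfree HG gr dg; pose K : smod F := spre (gcomb HG hg) P.
pose pF : smod F := sideal HG gr dg pp.1.
have [n' [dg' [g' [hg' [Kg' cg' _]]]]] := fK.
have pK : sle pF K.
  move=> v pv /=; apply: smod_sum => i _; have [N [_ ->]] := dcoefP HG (v 0 i).
  rewrite scaler_suml; apply: smod_sum => j _; rewrite -scalerA; apply: kPQ => //; exact: smodZ.
have [K' [K'K sp [c [pc Hc]]]] : exists K' : smod F, [/\ sle K' K, spec (pi := pi) pF K'
    & exists c, ~ p c /\ forall v, v \in [seq g' i | i : 'I_n'] -> K' (iota c *: v)].
  by apply: prime_step => // _ /mapP[i _ ->]; split; [apply: Kg'|exists (dg' i)].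
have {Hc}cK v : K v -> K' (iota c *: v).
  move=> /cg'[w /eqP]; rewrite subr_eq0 => /eqP ->; rewrite /comb scaler_sumr.
  apply: smod_sum => i _; rewrite scalerA mulrC -scalerA; apply: smodZ; apply: Hc.
  by apply: map_f; rewrite mem_enum.
have pK' : sle pF K' := spec_le sp.
have zK' : sle szero K' by move=> _ ->; apply: smod0.
have zpF : sle szero pF by move=> _ ->; apply: smod0.
have H := IH c pc.
have fT : FP 2 K' K.
  (* [K/K'] lies in the [c]-torsion [Nc/K'] of [F/K'], which is the kernel of
     multiplication by [c]; the induction hypothesis makes both cokernels
     [F/(K' + cF)] and [Nc/K] of type [FP n] for all [n]. *)
  have fF m : FP m.+1 K' sfull.
    apply: Res_quotient_free; apply: (RS_FP noe (m := 0)).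
    by apply: spec_trans sp; apply: spec_ideal.
  have full (S : smod F) : sle S sfull by [].
  pose S := sadd K' (simg (gscale F c) sfull).
  have K'S : sle K' S by move=> m; apply: saddl.
  have kS : killed (ideal_add p c) S sfull.
    move=> _ v [u [r [pu ->]]] _; rewrite rmorphD rmorphM scalerDl -scalerA.
    apply: smodD; first by apply/K'S/pK'; apply: sideal_kill.
    by apply: smodZ; apply: saddr; exists v.
  have fS : FP 2 S sfull.
    exact: FP_quotient K'S (full S) (fF 1%N) (FP_scale c (fF 0%N)).
  (* The indices descend with each kernel: [FP 4] for [F/S] gives [FP 3] for [S/K'], which
     multiplication by [c] identifies with [F/Nc], and then [FP 2] for [Nc/K']. *)
  have fK'S : FP 3 K' S.
    exact: FP_sub K'S (full S) (fF 2%N) (finite_sd_FP 4 H (full S) kS fS).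
  pose Nc := spre (gscale F c) K'.
  have K'N : sle K' Nc by move=> v K'v; apply: smodZ.
  have KN : sle K Nc by move=> v /cK.
  have fN : FP 3 Nc sfull.
    apply: (FP_closed HG gr 3).1 fK'S => //; apply: siso_sym.
    apply: (siso_map (f := gscale F c)) => // [v _|_ [u [_ [K'u [v _ ->] ->]]]].
      by apply: saddr; exists v.
    by exists v => //; rewrite addrK.
  have fK'N : FP 2 K' Nc by apply: FP_sub K'N (full Nc) (fF 1%N) fN.
  have fK'K : FP 1 K' K by apply: (FP_quotient zK' K'K) => //; exists n', dg', g', hg'.
  have fKN : FP 2 K Nc by apply: (FP_quotient K'K KN).
  apply: (FP_sub K'K KN fK'N); apply: finite_sd_FP H KN _ fKN.
  move=> _ v [u [r [pu ->]]] Nv; rewrite rmorphD rmorphM scalerDl -scalerA.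
  apply: smodD; first by apply: pK; apply: sideal_kill.
  by apply: smodZ; apply: K'K.
have kT : killed (ideal_add p c) K' K.
  move=> _ v [u [r [pu ->]]] Kv; rewrite rmorphD rmorphM scalerDl -scalerA.
  apply: smodD; first by apply: pK'; apply: sideal_kill.
  by apply: smodZ; apply: cK.
have [[m Hm] HB] := H _ _ _ K'K kT fT.
have main e : RS e K' K -> RS e.+1 P Q.
  move=> He; exists n, dg, g, hg; split=> //.
  apply: (RS_ext zK' K'K) => //; apply: (spec_RS HG noe).
  by apply: spec_trans sp; apply: spec_ideal.
split; first by exists m.+1; apply: main.
(* The chain consisting of [p] alone gives [d > 0]. A chain above [p + (c)] can be extended
   downwards by [p], strictly because [c] is outside [p], so the bound drops by one and pays for the
   syzygy. *)
move=> d Hd; have d0 : (0 < d)%N by apply: (Hd 0%N (fun _ => p)) => //; split.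
rewrite -(prednK d0); apply: main; apply: HB => e q cq aq.
rewrite -ltnS (prednK d0).
have pq b : p b -> q 0%N b by move=> pb; apply: aq; apply: ideal_add_sub => //; exact: pp.1.
apply: (Hd _ _ (prime_chain_cons pp cq pq _)) => //.
by exists c => //; apply: aq; apply: ideal_add_gen; exact: pp.1.
Qed.

Lemma finite_sdP a : is_ideal a -> finite_sd a.
Proof.
apply: noetherian_ind => // {}a ia IH.
have IHadd f : ~ a f -> finite_sd (ideal_add a f).
  move=> af; apply: IH; first exact: is_ideal_add.
    by move=> c; apply: ideal_add_sub.
  by exists f => //; apply: ideal_add_gen.
have [a1|na1] := pselect (a 1).
  move=> M P Q PQ kPQ _.
  have E : Q = P.
    by apply: smod_eq => v; split=> [Qv|/PQ //]; have := kPQ 1 v a1 Qv; rewrite rmorph1 scale1r.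
  by rewrite E; split=> [|d _]; [exists 0%N|]; apply: (spec_RS HG noe); apply: spec_refl.
have [pa|npa] := pselect (is_prime_ideal a); first exact: finite_sd_prime.
have [b [c [abc ab ac]]] : exists b c, [/\ a (b * c), ~ a b & ~ a c].
  apply: contrapT => H; apply: npa; do 2!split=> //.
  move=> b c abc; apply: contrapT => /not_orP[ab ac]; apply: H.
  by exists b, c.
by apply: (finite_sd_nonprime ia abc); apply: IHadd.
Qed.

End Finiteness.

(** * Submodules as modules in their own right *)

Section SubmoduleType.
Context {k D : comPzRingType} {iota : {rmorphism k -> D} } {x : nat -> D} {gr : bool}.
Variables (M : gmod iota x gr) (P : smod M).

Definition sub_pred : {pred M} := fun m => `[< P m >].

Lemma sub_pred_closed : subsemimod_closed sub_pred.
Proof.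
split; first split; rewrite ?unfold_in.
- by apply/asboolP; apply: smod0.
- by move=> u v /asboolP Pu /asboolP Pv; apply/asboolP; apply: smodD.
- by move=> a u /asboolP Pu; apply/asboolP; apply: smodZ.
Qed.

HB.instance Definition _ := GRing.isSubSemiModClosed.Build D M sub_pred sub_pred_closed.

(** A resolution consists of module types, whereas the syzygies above are predicates on free
    modules. *)
Record sub_type := SubType { sub_val : M; _ : sub_val \in sub_pred }.
HB.instance Definition _ := [isSub for sub_val].
HB.instance Definition _ := [Choice of sub_type by <:].
HB.instance Definition _ := [SubChoice_isSubLmodule of sub_type by <:].

Lemma sub_valP (u : sub_type) : P (sub_val u).
Proof. by have := valP u; rewrite unfold_in => /asboolP. Qed.

Lemma sub_lift m : P m -> exists u : sub_type, sub_val u = m.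
Proof. by move=> /asboolP Pm; exists (SubType Pm). Qed.

Lemma sub_grading : gr -> is_grading iota x (fun t (u : sub_type) => deg t (sub_val u)).
Proof.
move=> g; have [H0 [H1 [H2 [H3 [_ H5]]]]] := gmodP M g.
split; first by move=> t; apply: H0.
split; first by move=> t u v; apply: H1.
split; first by move=> t c u; apply: H2.
split; first by move=> t i u; apply: H3.
split.
  move=> u; have [l hl uE] := smod_dec (sub_valP u).
  have [l' hl' E'] : exists2 l' : seq (int * sub_type),
      (forall p, p \in l' -> deg p.1 (sub_val p.2)) & u = \sum_(p <- l') p.2.
    suff [l' hl' E'] : exists2 l' : seq (int * sub_type),
      (forall p, p \in l' -> deg p.1 (sub_val p.2)) &
        \sum_(p <- l) p.2 = sub_val (\sum_(p <- l') p.2).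
      by exists l' => //; apply: val_inj; rewrite /= -E' -uE.
    elim: l hl {uE} => [|p l IH] hl; first by exists [::]; rewrite // !big_nil.
    have [q ql|l' hl' E'] := IH; first by apply: hl; rewrite inE ql orbT.
    have [hp /sub_lift[w wE]] := hl p (mem_head _ _).
    exists ((p.1, w) :: l'); last by rewrite !big_cons /= E' -wE.
    by move=> q; rewrite inE => /orP[/eqP -> /=|/hl' //]; rewrite wE; apply: hp.
  exists (undup (map fst l')), (fun t => \sum_(p <- l' | p.1 == t) p.2); split.
  - exact: undup_uniq.
  - move=> t; rewrite -big_filter big_seq; apply: (big_ind (fun v => deg t (sub_val v))).
    + exact: H0.
    + by move=> u' v; apply: H1.
    + by move=> p; rewrite mem_filter => /andP[/eqP <- /hl'].
  - by rewrite -sum_regroup.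
move=> s f us hf S0 t ts; apply: val_inj; apply: (H5 s (fun t => sub_val (f t)) us hf) => //.
by rewrite -(raddf_sum (\val : sub_type -> M)) S0.
Qed.

Definition gsub : gmod iota x gr := Gmod sub_grading.

Definition gincl : gmap gsub M :=
  @Gmap _ _ _ _ _ gsub M sub_val (fun a u v => erefl) (fun t u h => h).
End SubmoduleType.

(** * Assembling special resolutions from syzygies *)

Section Resolutions.
Context {k D : comPzRingType} {iota : {rmorphism k -> D} } { pi : nat -> k}
  {x : nat -> D} (HG : is_GDPA iota pi x) (gr : bool).
Local Notation gmod := (gmod iota x gr).
Local Notation spc := (@spec k D iota pi x gr).
Local Notation spec := (spec (pi := pi)).

Lemma gcomp_lin (A B C : gmod) (f : gmap B C) (g : gmap A B) : Dlinear (f \o g).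
Proof. by move=> a u v /=; rewrite !gmapZD. Qed.
Definition gcomp (A B C : gmod) (f : gmap B C) (g : gmap A B) : gmap A C :=
  Gmap (gcomp_lin f g) (fun t m h => gmap_hom f (gmap_hom g h)).

Lemma gzero_lin (A B : gmod) : Dlinear (fun _ : A => 0 : B).
Proof. by move=> a u v; rewrite scaler0 addr0. Qed.
Definition gzero (A B : gmod) : gmap A B := Gmap (@gzero_lin A B) (fun t m h => hom0 t).

Definition graded_resolution (M : gmod) (n : nat) :=
  exists (S : nat -> gmod) (d : forall i, gmap (S i.+1) (S i)) (ep : gmap (S 0%N) M),
  [/\ forall m, exists s, ep s = m,
      forall s, ep s = 0 <-> exists t, d 0%N t = s,
      forall i s, d i s = 0 <-> exists t, d i.+1 t = s,
      forall i, spec (szero : smod (S i)) sfull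
    & forall i, (n < i)%N -> forall s : S i, s = 0].

Lemma RS_resolution n (M : gmod) :
  Res HG spc n (szero : smod M) sfull -> graded_resolution M n.
Proof.
elim: n M => [|n IH] M.
  (* The free module of rank 0 serves as the zero module beyond the end of the resolution; it is
     special like every finite free module. *)
  move=> /= sp; pose Z := gfree HG gr (fun _ : 'I_0 => 0).
  have Z0 (z : Z) : z = 0 by apply: thinmx0.
  exists (fun i => if i is 0 then M else Z), (fun i => gzero _ _), (gid M); split.
  - by move=> m; exists m.
  - by move=> s; split=> [s0|[_ <-]] //; exists 0; symmetry; exact: s0.
  - by move=> i s; split=> // _; exists 0; rewrite [s]Z0.
  - by case=> [|i] //; apply: spec_free.
  - by case.
move=> [r [dg [g [hg [_ cg XK]]]]].
pose K := spre (gcomb HG hg) (szero : smod M).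
have /IH[S [d [ep [sur ex0 ex sp van]]]] : Res HG spc n (szero : smod (gsub K)) sfull.
  apply: (Res_closed HG n (@spec_closed k D iota pi x gr)).1 XK => //.
  apply: siso_sym; apply: (siso_map (f := gincl K)) => //.
  - by move=> m ->; apply: smod0.
  - by move=> u _; apply: sub_valP.
  - by move=> u _; split=> [->|u0]; [apply: gmap0|apply: val_inj].
  - by move=> v /sub_lift[u <-]; exists u => //=; rewrite subrr.
pose S' i := if i is j.+1 then S j else gfree HG gr dg.
exists S', (fun i => match i return gmap (S' i.+1) (S' i) with
  | j.+1 => d j | 0%N => gcomp (gincl K) ep end), (gcomb HG hg).
have inj u : gincl K u = 0 -> u = 0 by move=> u0; apply: val_inj.
split.
- move=> m; have [v /eqP] := cg m I; rewrite subr_eq0 => /eqP ->.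
  by exists v.
- move=> v; split=> [v0|[t <-]]; last exact: (sub_valP (ep t)).
  by have [u <-] := sub_lift (P := K) v0; have [s <-] := sur u; exists s.
- move=> [|i] s; last exact: ex.
  by rewrite -ex0; split=> [/inj|/= ->]; [|exact: (gmap0 (gincl K))].
- by case=> [|i]; [exact: (spec_free HG gr dg)|exact: sp].
- by case=> [|i] //; apply: van.
Qed.

Lemma spec_chain (M : gmod) (P Q : smod M) : spec P Q ->
  exists (r : nat) (F : nat -> smod M), [/\ F 0%N = P, F r = Q,
    forall j, sle (F j) (F j.+1) & forall j, (j < r)%N -> psp (pi := pi) (F j) (F j.+1)].
Proof.
elim=> [|{}Q R _ [r [F [F0 Fr Fle Fp]]] QR pQR]; first by exists 0%N, (fun _ => P);
  split=> // j m.
exists r.+1, (fun j => if (j <= r)%N then F j else R); split=> //.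
- by rewrite ltnn.
- move=> j; case: (ltngtP j r) => [jr|rj|->]; last by rewrite Fr.
    exact: Fle.
  by [].
- move=> j; rewrite ltnS; case: (ltngtP j r) => [jr|//|->] _; last by rewrite Fr.
  exact: Fp.
Qed.

Lemma spec_special (M : gmod) : spec (szero : smod M) sfull ->
  special iota pi x gr (@deg _ _ _ _ _ M).
Proof.
move=> /spec_chain[r [F [F0 Fr Fle Fp]]]; exists r, F; split; first by move=> m; rewrite F0.
split; first by rewrite Fr.
by split=> //; split=> // j; apply: smodP.
Qed.

Lemma resolution_special (M : gmod) n : graded_resolution M n ->
  special_resolution_of_length iota pi x gr (@deg _ _ _ _ _ M) n.
Proof.
move=> [S [d [ep [sur ex0 ex sp van]]]].
exists (fun i => S i : lmodType D), (fun i => @deg _ _ _ _ _ (S i)),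
  (fun i => d i : S i.+1 -> S i), ep.
split; first by split=> [i|]; apply: gmap_lin.
do 3!split=> //; split; first by move=> i; apply: spec_special.
split=> // g; split; first by move=> i; apply: gmodP.
split=> [i t s hs|t s hs]; first exact: (gmap_hom (d i) (fun _ => hs) g).
exact: (gmap_hom ep (fun _ => hs) g).
Qed.
End Resolutions.

(* gr = true: graded case (H is the grading of M); gr = false: ungraded
   case (H is then irrelevant). *)
Theorem theorem5p1 (k : comPzRingType) (D : comPzRingType)
  (iota : {rmorphism k -> D}) (pi : nat -> k) (x : nat -> D)
  (gr : bool) (M : lmodType D) (H : int -> M -> Prop) :
  noetherian (k := k) ->
  is_GDPA iota pi x ->
  (gr -> is_grading iota x H) ->
  fin_presented iota x gr H ->
  (exists n : nat, special_resolution_of_length iota pi x gr H n) /\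
  (forall d : nat, krull_dim (k := k) d ->
     special_resolution_of_length iota pi x gr H d.+1).
Proof.
move=> noe HG HM [n [g [dg [r [rel [rdg [hg [hrel [gen [rel0 relP]]]]]]]]]].
pose M' := Gmod HM.
have hg' i : hom (M := M') (dg i) (g i) by move=> G; apply: hg.
have combE (a : 'I_n -> D) : comb (M := M') g (\row_i a i) = \sum_(i < n) a i *: g i.
  by apply: eq_bigr => i _; rewrite mxE.
have fp : FP HG 2 (szero : smod M') sfull.
  exists n, dg, g, hg'; split=> //.
    by move=> m _; have [a ->] := gen m; exists (\row_i a i); rewrite combE subrr.
  have hr l : hom (M := gfree HG gr dg) (rdg l) (\row_i rel l i).
    by move=> G i; rewrite mxE; apply: hrel.
  exists r, rdg, (fun l => \row_i rel l i), hr; split=> //.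
    by move=> l; rewrite /= combE.
  move=> v /= v0; have [b bE] := relP (fun i => v 0 i) v0.
  exists (\row_l b l); apply/eqP; rewrite subr_eq0; apply/eqP/rowP => i.
  by rewrite bE summxE; apply: eq_bigr => l _; rewrite !mxE.
have iz : is_ideal (fun c : k => c = 0) by apply: (is_ideal_gen [::]).
have kill : killed (fun c : k => c = 0) (szero : smod M') sfull.
  by move=> c v -> _; rewrite rmorph0 scale0r.
have [[e He] Hd] := finite_sdP noe iz (fun _ _ => I : (sfull : smod M') _) kill fp.
split; first by exists e; apply: (@resolution_special _ _ _ _ _ gr M'); apply: RS_resolution He.
move=> d [_ Kd]; apply: (@resolution_special _ _ _ _ _ gr M'); apply: (RS_resolution (HG := HG)).
by apply: Hd => m q cq _; rewrite ltnS; apply: Kd cq.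
Qed.
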